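(* For every integer $n\ge 1$ let $(X_{i,n},Y_{i,n})_{i=1,\dots,n}$ be i.i.d. with distribution $P_{X,Y,n}$ on $\mathbb{R}^2$ satisfying $\mathbb{E}[Y_{1,n}]>0$, $\mathbb{E}[X_{1,n}^2]<+\infty$ and $\mathbb{E}[Y_{1,n}^2]<+\infty$. Assume that (i) there are sequences of positive reals $(\gamma_{X,n})_{n\ge1}$, $(\gamma_{Y,n})_{n\ge1}$ and a (symmetric) positive definite $2\times2$ matrix $V$ such that the covariance matrix $\mathbb{V}[(\gamma_{X,n}X_{1,n},\gamma_{Y,n}Y_{1,n})]\to V$ as $n\to\infty$; (ii) $\sup_{n\ge1}\mathbb{E}\big[|X_{1,n}|^3\gamma_{X,n}^3+|Y_{1,n}|^3\gamma_{Y,n}^3\big]<+\infty$; (iii) $\mathbb{P}(\overline{Y}_n=0)\to0$ as $n\to\infty$. Let $\mathrm{SNR}_n:=\mathbb{E}[Y_{1,n}]/\big(V_{2,2}^{1/2}n^{-1/2}\gamma_{Y,n}^{-1}\big)$ and $$S_n:=\sqrt n\left(\frac{\overline{X}_n}{\overline{Y}_n}-\frac{\mathbb{E}[X_{1,n}]}{\mathbb{E}[Y_{1,n}]}\right).$$ Then, as $n\to\infty$: 1. If $\mathrm{SNR}_n\to+\infty$, then $S_n$ is equivalent in distribution to $$\frac{\sqrt n\,\gamma_{X,n}(\overline{X}_n-\mathbb{E}[X_{1,n}])}{\mathbb{E}[Y_{1,n}]\,\gamma_{X,n}}-\frac{\sqrt n\,\gamma_{Y,n}(\overline{Y}_n-\mathbb{E}[Y_{1,n}])\,\mathbb{E}[X_{1,n}]}{\mathbb{E}[Y_{1,n}]^2\,\gamma_{Y,n}}.$$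 2. If there exists a finite constant $C\neq0$ such that $V_{2,2}^{1/2}\,\mathrm{SNR}_n=\sqrt n\,\gamma_{Y,n}\mathbb{E}[Y_{1,n}]\to C$, then $S_n$ is equivalent in distribution to $$n\,\gamma_{Y,n}\mathbb{E}[X_{1,n}]\left(\frac{1}{C+\sqrt n\,\gamma_{Y,n}(\overline{Y}_n-\mathbb{E}[Y_{1,n}])}-\frac1C\right)+\frac{n\,\gamma_{X,n}(\overline{X}_n-\mathbb{E}[X_{1,n}])\,\gamma_{Y,n}}{\big(C+\sqrt n\,\gamma_{Y,n}(\overline{Y}_n-\mathbb{E}[Y_{1,n}])\big)\,\gamma_{X,n}}.$$ 3. If $\mathrm{SNR}_n\to0$, then $S_n$ is equivalent in distribution to $$\sqrt n\left(\frac{\sqrt n\,\gamma_{X,n}(\overline{X}_n-\mathbb{E}[X_{1,n}])}{\sqrt n\,\gamma_{Y,n}(\overline{Y}_n-\mathbb{E}[Y_{1,n}])}\times\frac{\gamma_{Y,n}}{\gamma_{X,n}}-\frac{\mathbb{E}[X_{1,n}]}{\mathbb{E}[Y_{1,n}]}\right).$$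
   Context: Notation: $\overline{U}_n:=n^{-1}\sum_{i=1}^nU_{i,n}$ is the empirical mean. Ratios with zero denominator are undefined. Two sequences of random variables $(S_n)$ and $(T_n)$ are called equivalent in distribution if there exist a probability space $\tilde\Omega$ and two sequences of random variables $\tilde S_n,\tilde T_n$ on it such that for every $n\ge1$, $\tilde S_n$ has the same distribution as $S_n$ and $\tilde T_n$ has the same distribution as $T_n$, and $\tilde S_n$ is equivalent to $\tilde T_n$ almost surely as $n\to\infty$; that is, for almost every $\tilde\omega\in\tilde\Omega$, the deterministic real sequences $\tilde S_n(\tilde\omega)$ and $\tilde T_n(\tilde\omega)$ (which are well-defined for $n$ large enough) are equivalent as $n\to\infty$ ($a_n\sim b_n$, i.e. $a_n=b_n(1+o(1))$). *)

(* Defs.v *)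
From HB Require Import structures.
From mathcomp Require Import all_boot all_order all_algebra.
From mathcomp Require Import all_classical all_reals all_analysis.

Set Implicit Arguments.
Unset Strict Implicit.
Unset Printing Implicit Defensive.

Import Order.TTheory GRing.Theory Num.Theory.
Import numFieldNormedType.Exports.

Local Open Scope classical_set_scope.
Local Open Scope ring_scope.

Definition empirical_mean (R : realType) (T : Type) (m : nat)
    (U : 'I_m -> T -> R) (w : T) : R :=
  m%:R^-1 * \sum_(i < m) U i w.

Definition mutually_independent d (T : measurableType d) d'
    (T' : measurableType d') (R : realType) (P : probability T R)
    (I : finType) (Z : I -> T -> T') : Prop :=
  forall (J : {set I}) (A : I -> set T'),
    (forall i, measurable (A i)) ->
    P (\bigcap_(i in [set` J]) (Z i @^-1` A i)) =
    (\prod_(i in J) P (Z i @^-1` A i))%E.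

Definition iid_with_law d (T : measurableType d) d' (T' : measurableType d')
    (R : realType) (P : probability T R) (mu : probability T' R)
    (I : finType) (Z : I -> T -> T') : Prop :=
  (forall i (A : set T'), measurable A -> P (Z i @^-1` A) = mu A) /\
  mutually_independent P Z.

Definition covariance_matrix d (T : measurableType d) (R : realType)
    (P : probability T R) (k : nat) (U : 'I_k -> T -> R) : 'M[R]_k :=
  \matrix_(i < k, j < k) fine (covariance P (U i) (U j)).

Definition positive_definite (R : realType) (k : nat) (V : 'M[R]_k) : Prop :=
  V^T = V /\ forall v : 'rV[R]_k, v != 0 -> 0 < (v *m V *m v^T) 0 0.

(* A random variable that may be undefined (a ratio with zero denominator) is
   an [option R]-valued function, [None] meaning "undefined". *)
Definition defined_if (R : Type) (b : bool) (x : R) : option R :=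
  if b then Some x else None.

Definition partial_RV d (T : measurableType d) (R : realType)
    (S : T -> option R) : Prop :=
  forall B : set R, measurable B -> measurable (S @^-1` (Some @` B)).

(* Taking [B := setT] shows that the probabilities of being undefined agree. *)
Definition same_distribution d (T : measurableType d) d'
    (T' : measurableType d') (R : realType) (P : probability T R)
    (P' : probability T' R) (S : T -> option R) (S' : T' -> option R) : Prop :=
  [/\ partial_RV S, partial_RV S' &
    forall B : set R, measurable B ->
      P (S @^-1` (Some @` B)) = P' (S' @^-1` (Some @` B))].

(* The default value 0 is irrelevant: both sequences are eventually defined. *)
Definition partial_equivalent (R : realType) (s t : nat -> option R) : Prop :=
  (\forall n \near \oo, s n /\ t n) /\
  (fun n => odflt 0 (s n)) ~_\oo (fun n => odflt 0 (t n)).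

Definition equivalent_in_distribution (R : realType) (d : nat -> measure_display)
    (T : forall n, measurableType (d n)) (P : forall n, probability (T n) R)
    (S S' : forall n, T n -> option R) : Prop :=
  exists (e : measure_display) (W : measurableType e) (Q : probability W R)
         (St St' : nat -> W -> option R),
    [/\ forall n, same_distribution Q (P n) (St n) (S n),
        forall n, same_distribution Q (P n) (St' n) (S' n) &
        {ae Q, forall w, partial_equivalent (St ^~ w) (St' ^~ w)}].

(* Main.v *)
(* No central limit theorem is needed. Write A, B for the normalized fluctuations of the two
   empirical means and t = sqrt n * gammaY * E Y for the normalized mean of Y. Each of the
   three equivalents is an explicit multiple of S_n; the multiplier tends to 1 as soon as
   B / t (case 1), t / B (case 3), or (t - C) / (C + B) and A (t - C) / (C A - r B) with
   r = sqrt n * gammaX * E X (case 2) tend to 0. Chebyshev's inequality bounds the numerators.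
   For the denominators, every unit combination of A and B satisfies P(|. - y| <= delta_n) -> 0
   uniformly in y when delta_n -> 0: by independence and the third moments its characteristic
   function is small away from the origin. Hence the multiplier is close to 1 on events of
   probability tending to 1. Finally, encoding the plane measurably into the line, the law of
   the pair of empirical means is realized for every n by a quantile transform of one uniform
   variable u, in such a way that for almost every u all but finitely many n are in these
   good events. *)
Require Import Defs.
From HB Require Import structures.
From mathcomp Require Import all_boot all_order all_algebra.
From mathcomp Require Import all_classical all_reals all_analysis.
From mathcomp Require Import unstable measurable_realfun.
From mathcomp Require Import ring lra zify.

Set Implicit Arguments.
Unset Strict Implicit.
Unset Printing Implicit Defensive.

Import Order.TTheory GRing.Theory Num.Theory.
Import numFieldNormedType.Exports.

Local Open Scope classical_set_scope.
Local Open Scope ring_scope.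

(** The equivalence is relative and the law of S_n need not converge: r = sqrt n * gammaX * E X may
    be unbounded, and an equivalent may come close to 0. What is needed is therefore a lower bound
    on the equivalents themselves, not a limit law. One numerator governs everything: t A - r B = n
    gammaX gammaY (Xbar E Y - E X Ybar). It is shared by S_n and by the equivalents of cases 1 and
    3, which differ from S_n only in the denominator; case 2 also replaces it by C A - r B, whose
    direction moves with n. This is why the anti-concentration bound must be uniform over directions
    and over rows. A multiplier tending to 1 in probability does not tend to 1 almost surely under
    an arbitrary coupling. Only the law of each row is prescribed, however, so the rows may be
    coupled freely: if the bad set of row n has mass p_n, it is placed above u = 1 - p_n. Every u <
    1 then leaves the bad sets as soon as p_n < 1 - u, with no summability of the p_n. The pair of
    means is coupled, rather than S_n and its equivalent separately, so that the algebraic identity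
    between them holds pointwise. *)

(** * Quantile transform of a uniform variable *)

Section quantile.
Context d (T : measurableType d) (R : realType) (P : probability T R).
Variable X : {RV P >-> R}.

Let F (x : R) : R := fine (cdf X x).

Let FE x : (F x)%:E = cdf X x.
Proof. by rewrite fineK// fin_num_measure. Qed.

Let F_nd x y : x <= y -> F x <= F y.
Proof. by move=> xy; rewrite fine_le ?fin_num_measure// cdf_nondecreasing. Qed.

(** Outside []0, 1[] the set may be empty or unbounded below; the value 0 put there only matters on
    a null set. *)
Definition quantile (u : R) : R :=
  if u \in `]0, 1[ then inf [set x | u <= fine (cdf X x)] else 0.

Let F_has_inf u : u \in `]0, 1[ -> has_inf [set x | u <= F x].
Proof.
rewrite in_itv/= => /andP[u0 u1]; split.
- have F1 : F @ +oo --> (1 : R) by exact/fine_cvg/cvg_cdfy1.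
  by have [x /ltW ux] := filter_ex (cvgr_gt _ F1 _ u1); exists x.
- have F0 : F @ -oo --> (0 : R) by exact/fine_cvg/cvg_cdfNy0.
  have [x Fxu] := filter_ex (cvgr_lt _ F0 _ u0).
  exists x => y /= uy; rewrite leNgt; apply/negP => /ltW /F_nd.
  by rewrite leNgt (lt_le_trans Fxu).
Qed.

(** By right continuity, if [F x < u] then still [F y < u] for some [y > x], and the infimum is at
    least this [y]. So the equivalence holds with non-strict inequalities on both sides. *)
Lemma quantile_le u x : u \in `]0, 1[ ->
  (quantile u <= x) = (u <= fine (cdf X x)).
Proof.
move=> u01; rewrite /quantile u01; have uI := F_has_inf u01.
apply/idP/idP => [|uF]; last by apply: ge_inf => //; exact: uI.2.
apply: contraTT; rewrite -!ltNge => Fu.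
have F_rc : F y @[y --> x^'+] --> F x.
  by apply: fine_cvg; rewrite FE; exact: cdf_right_continuous.
have : \forall y \near x^'+, x < y /\ F y < u.
  near=> y; split; first by near: y; exact: nbhs_right_gt.
  by near: y; exact: cvgr_lt F_rc _ Fu.
move=> /filter_ex[y [xy Fy]]; apply: (lt_le_trans xy).
apply: lb_le_inf; first exact: uI.1.
move=> z /= uz; rewrite leNgt; apply/negP => /ltW /F_nd.
by rewrite leNgt (lt_le_trans Fy).
Unshelve. all: by end_near. Qed.

(** The second piece accounts for the default value 0, which exceeds [x] exactly when [x < 0]. *)
Let preimage_quantile x : quantile @^-1` `]x, +oo[ =
  (`]0, 1[ `&` `]F x, +oo[) `|` (if x < 0 then ~` `]0, 1[ else set0).
Proof.
apply/seteqP; split => u /=; rewrite !in_itv/= !andbT.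
  have [u01|u01] := boolP (u \in `]0, 1[).
    by rewrite ltNge quantile_le// -ltNge => ?; left; split.
  rewrite /quantile (negbTE u01) => ->; right => /=.
  exact/negP.
case=> [[u01 xu]|]; first by rewrite ltNge quantile_le// -ltNge.
by case: ifPn => // x0 /= /negP u01; rewrite /quantile (negbTE u01).
Qed.

Lemma measurable_quantile :
  @measurable_fun _ _ (measurableTypeR R) R setT quantile.
Proof.
apply: (measurability (@measurable_realfun.RGenOInfty.G R)).
  exact: measurable_realfun.RGenOInfty.measurableE.
move=> _ [_ [x ->] <-]; rewrite setTI preimage_quantile.
by apply: measurableU; [exact: measurableI|case: ifP => // _; exact: measurableC].
Qed.

Let uniform_quantile_gt x :
  uniform_prob (@ltr01 R) (quantile @^-1` `]x, +oo[) = P (X @^-1` `]x, +oo[).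
Proof.
have F01 : 0 <= F x <= 1.
  by rewrite -2!lee_fin FE cdf_ge0 cdf_le1.
rewrite preimage_quantile /uniform_prob integral_uniform_pdf.
rewrite (eq_integral (cst 1%E)); last first.
  move=> u; rewrite inE => -[_]; rewrite /= in_itv/= /uniform_pdf => ->.
  by rewrite subr0 invr1.
rewrite integral_cst ?mul1e; last first.
  apply: measurableI => //; apply: measurableU; first exact: measurableI.
  by case: ifP => // _; exact: measurableC.
(* The uniform density lives on the closed interval, so the default value contributes at most its
   two endpoints, a null set. *)
rewrite (_ : _ `&` _ = `]F x, 1[ `|` (if x < 0 then [set 0; 1] else set0)).
  rewrite measureU0//=.
  - rewrite lebesgue_measure_itv/= lte_fin.
    have -> : P (X @^-1` `]x, +oo[) = (1 - F x)%:E.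
      by rewrite EFinB FE -[1%:E](cdf_ccdf_1 X x) addeAC subee ?add0e// -FE.
    case: ifPn => //; rewrite -leNgt => F1.
    by congr EFin; apply/esym; lra.
  - case: ifP => // _; exact: measurableU.
  - case: ifP => // _; apply: countable_lebesgue_measure0.
    exact: finite_set_countable.
apply/seteqP; split => u /=; rewrite !in_itv/= ?andbT.
  move=> [[[u01 Fu]|]]; first by left; rewrite Fu; case/andP: u01.
  case: ifPn => //= x0 /negP; rewrite in_itv/= negb_and -!leNgt => + /andP[u0 u1].
  by case/orP => ?; right; [left|right]; lra.
case=> [/andP[Fu u1]|].
  by split; [left; lra|lra].
case: ifPn => //= x0 [] ->; split; rewrite ?ler01 ?lexx//; right => /=; rewrite in_itv/=; lra.
Qed.

Lemma uniform_quantile (B : set R) : measurable B ->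
  uniform_prob (@ltr01 R) (quantile @^-1` B) = P (X @^-1` B).
Proof.
move=> mB.
pose q : {mfun measurableTypeR R >-> R} :=
  @mfun_Sub _ _ (measurableTypeR R) R quantile (mem_set measurable_quantile).
pose U := distribution (uniform_prob (@ltr01 R)) q.
apply: (measure_unique (@measurable_realfun.RGenOInfty.G R)
  (fun n => `](- n%:R), +oo[%classic) _ _ _ _ U (distribution P X)) => //.
- exact: measurable_realfun.RGenOInfty.measurableE.
- move=> _ _ [a ->] [b ->]; exists (Order.max a b).
  apply/seteqP; split => z /=; rewrite !in_itv/= !andbT gt_max.
    by move=> [-> ->].
  by move=> /andP.
- by move=> n; exists (- n%:R).
- apply/seteqP; split => // z _; exists (Num.bound z) => //=.
  by rewrite in_itv/= andbT ltrNl; exact: unstable.ltrNbound.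
- by move=> _ [x ->]; exact: uniform_quantile_gt.
- by move=> n; rewrite (le_lt_trans (probability_le1 _ _)) ?ltry.
Qed.

End quantile.

(** * Coding a sequence of bits by a point of the Cantor set *)

(* The digits 0 and 2 leave a gap in the middle third, so that reading a digit back is
   a mere comparison with 1/2. *)
Section cantor_series.
Context (R : realType).
Implicit Types b : nat -> bool.

Definition cantor_term b (k : nat) : R := 2 * (b k)%:R / 3 ^+ k.+1.

Definition cantor_sum b : R := limn (series (cantor_term b)).

Lemma cantor_term_ge0 b k : 0 <= cantor_term b k.
Proof. by rewrite mulr_ge0// ?mulr_ge0// invr_ge0 exprn_ge0. Qed.

Let series_le b n : series (cantor_term b) n <= 1 - 3 ^- n.
Proof.
elim: n => [|n IH]; first by rewrite /series/= big_geq// expr0 invr1 subrr.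
rewrite seriesSr/= (le_trans (lerD IH (lexx _)))// /cantor_term.
have -> : (3 : R) ^- n = 3 * 3 ^- n.+1 by rewrite exprS invfM mulrA divff ?mul1r.
have h : 0 <= (3 : R) ^- n.+1 by rewrite invr_ge0 exprn_ge0.
by case: (b n) => /=; rewrite ?mulr1 ?mulr0; lra.
Qed.

Lemma cvg_cantor_sum b : series (cantor_term b) @ \oo --> cantor_sum b.
Proof.
apply: nondecreasing_is_cvgn.
  by apply: nondecreasing_series => k _ _; exact: cantor_term_ge0.
by exists 1 => _ [n _ <-]; rewrite (le_trans (series_le b n))// gerBl invr_ge0 exprn_ge0.
Qed.

Lemma cantor_sum_itv b : 0 <= cantor_sum b <= 1.
Proof.
have cb := cvgP _ (@cvg_cantor_sum b).
rewrite limr_ge ?limr_le//; apply: nearW => n.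
  by rewrite (le_trans (series_le b n))// gerBl invr_ge0 exprn_ge0.
by rewrite sumr_ge0// => k _; exact: cantor_term_ge0.
Qed.

(** Self-similarity of the Cantor set: tripling brings the first digit in front of the Cantor sum of
    the remaining bits. Decoding inverts this step repeatedly. *)
Lemma cantor_sum_shift b :
  3 * cantor_sum b = 2 * (b 0)%:R + cantor_sum (b \o succn).
Proof.
have seriesS n : 3 * series (cantor_term b) n.+1 =
    2 * (b 0)%:R + series (cantor_term (b \o succn)) n.
  rewrite /series/= big_nat_recl//= mulrDr /cantor_term/= expr1.
  congr (_ + _); first by field.
  rewrite mulr_sumr; apply: eq_bigr => k _; rewrite (exprS _ k.+1) invfM.
  by field; rewrite expf_neq0.
have l1 : (fun n => 3 * series (cantor_term b) n.+1) @ \oo --> 3 * cantor_sum b.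
  apply: cvgMr; apply: (cvg_comp (addn 1)); last exact: cvg_cantor_sum.
  exact: cvg_addnl.
apply: (cvg_unique _ l1) => //; rewrite (funext seriesS).
by apply: cvgD; [exact: cvg_cst|exact: cvg_cantor_sum].
Qed.

(** Iterates of the ternary shift. A Cantor sum lies in [0, 1/3] or [2/3, 1] according to its first
    bit, so the digit to subtract is found by comparing with 1/2. *)
Fixpoint cantor_rem (c : R) k :=
  if k is k'.+1 then
    3 * cantor_rem c k' - (if 2^-1 <= cantor_rem c k' then 2 else 0)
  else c.

Definition cantor_bit (c : R) k := 2^-1 <= cantor_rem c k.

Lemma cantor_remE b k :
  cantor_rem (cantor_sum b) k = cantor_sum (fun i => b (k + i)%N).
Proof.
elim: k => [//|k IH] /=; rewrite IH.
have := cantor_sum_itv (fun i => b (k + i)%N).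
have := cantor_sum_itv (fun i => b (k.+1 + i)%N).
have := cantor_sum_shift (fun i => b (k + i)%N).
rewrite addn0 (_ : _ \o _ = fun i => b (k.+1 + i)%N); last first.
  by apply/funext => i; rewrite /= addnS.
by case: (b k) => /=; case: ifPn; rewrite ?mulr1 ?mulr0; lra.
Qed.

Lemma cantor_bitE b k : cantor_bit (cantor_sum b) k = b k.
Proof.
rewrite /cantor_bit cantor_remE.
have := cantor_sum_itv (fun i => b (k.+1 + i)%N).
have := cantor_sum_shift (fun i => b (k + i)%N).
rewrite addn0 (_ : _ \o _ = fun i => b (k.+1 + i)%N); last first.
  by apply/funext => i; rewrite /= addnS.
by case: (b k) => /=; rewrite ?mulr1 ?mulr0 => ? ?; [apply/idP|apply/negP/negP]; lra.
Qed.

Lemma measurable_cantor_bit k : measurable_fun setT (cantor_bit ^~ k).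
Proof.
suff m : measurable_fun setT (cantor_rem ^~ k) by exact: measurable_fun_ler.
elim: k => [|k IH] /=; first exact: measurable_id.
apply: measurable_funB; first exact: measurable_funM.
by apply: measurable_fun_ifT => //; exact: measurable_fun_ler.
Qed.

Lemma measurable_cantor_sum d (T : measurableType d) (b : T -> nat -> bool) :
  (forall k, measurable_fun setT (b ^~ k)) ->
  measurable_fun setT (cantor_sum \o b).
Proof.
move=> mb; apply: (@measurable_fun_cvg _ T R setT (fun n t => series (cantor_term (b t)) n)).
  move=> n; rewrite /series/=; apply: measurable_sum => k.
  rewrite /cantor_term; apply: measurable_funM => //; apply: measurable_funM => //.
  have -> : (fun t => (b t k)%:R) = (fun t => if b t k then 1 else 0 : R).
    by apply/funext => t; case: (b t k).
  exact: measurable_fun_ifT.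
by move=> t _; exact: cvg_cantor_sum.
Qed.

End cantor_series.

(** * Measurable coding of the plane by the line *)

(* A point of the plane is determined by the Dedekind cuts of its coordinates; coding these
   countably many bits by a single real gives a measurable injection of the plane into the
   line with a measurable left inverse, which replaces the Borel isomorphism theorem. *)
Section plane_encoding.
Context (R : realType).

(** An enumeration of the rationals with repetitions: indices that code no rational give 0, which is
    harmless since [cutE] only needs each rational to occur. *)
Let q k : R := ratr (odflt 0 (unpickle k)).

Definition plane_bits (z : R * R) (k : nat) : bool :=
  if odd k then q k./2 < z.2 else q k./2 < z.1.

Definition plane_code (z : R * R) : R := cantor_sum R (plane_bits z).

(** The supremum is taken in the extended reals: a false bit contributes -oo, and measurability
    reduces to that of a countable supremum. *)
Let cut (b : nat -> bool) : R :=
  fine (esups (fun k => if b k then (q k)%:E else -oo%E) 0).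

Definition plane_decode (c : R) : R * R :=
  (cut (fun k => cantor_bit c k.*2), cut (fun k => cantor_bit c k.*2.+1)).

Let cutE x : cut (fun k => q k < x) = x.
Proof.
rewrite /cut /esups/=; transitivity (fine x%:E) => //; congr fine.
apply/eqP; rewrite eq_le; apply/andP; split.
  apply: ge_ereal_sup => _ [k _ <-]; case: ifPn => [/ltW|_]; last exact: leNye.
  by rewrite lee_fin.
apply/lee_subgt0Pr => e e0.
have [r] := @rat_in_itvoo R (x - e) x ltac:(by rewrite ltrBlDr ltrDl).
rewrite in_itv/= => /andP[/ltW er rx].
have qr : q (pickle r) = ratr r by rewrite /q pickleK.
apply: le_ereal_sup_tmp; exists (q (pickle r))%:E; last by rewrite qr lee_fin.
by exists (pickle r) => //=; rewrite qr rx.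
Qed.

Lemma plane_codeK : cancel plane_code plane_decode.
Proof.
move=> [x y]; rewrite /plane_decode /plane_code.
have -> : (fun k => cantor_bit (cantor_sum R (plane_bits (x, y))) k.*2) =
    (fun k => q k < x).
  by apply/funext => k; rewrite cantor_bitE /plane_bits odd_double doubleK.
have -> : (fun k => cantor_bit (cantor_sum R (plane_bits (x, y))) k.*2.+1) =
    (fun k => q k < y).
  by apply/funext => k; rewrite cantor_bitE /plane_bits /= odd_double uphalf_double.
by rewrite !cutE.
Qed.

Lemma plane_code_itv z : 0 <= plane_code z <= 1.
Proof. exact: cantor_sum_itv. Qed.

Lemma measurable_plane_code : measurable_fun setT plane_code.
Proof.
apply: measurable_cantor_sum => k; rewrite /plane_bits.
by case: odd; exact: measurable_fun_ltr.
Qed.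

Lemma measurable_plane_decode : measurable_fun setT plane_decode.
Proof.
have m (f : nat -> nat) :
    measurable_fun setT (fun c : R => cut (fun k => cantor_bit c (f k))).
  rewrite /cut; apply: measurableT_comp; first exact: fine_measurable.
  apply: (measurable_fun_esups (f := fun k (c : R) =>
    if cantor_bit c (f k) then (q k)%:E else -oo%E)) => k.
  by apply: measurable_fun_ifT => //; exact: measurable_cantor_bit.
by apply: measurable_fun_pair; exact: m.
Qed.

End plane_encoding.

(** * Coupling all the rows on the unit interval *)

Section coupling.
Context (R : realType) (d : nat -> measure_display)
  (Omega : forall n, measurableType (d n)) (P : forall n, probability (Omega n) R).
Variables (Z : forall n, Omega n -> R * R) (G : nat -> set (R * R)).
Arguments Z : clear implicits.
Hypothesis mZ : forall n, measurable_fun setT (Z n).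
Hypothesis mG : forall n, measurable (G n).
Hypothesis PG : (fun n => P n (Z n @^-1` G n)) @ \oo --> 1%E.

Let W := measurableTypeR R.
Let Q : probability W R := uniform_prob (@ltr01 R).

(* Good points are sent to [0, 1] and bad ones to [2, 3], so the quantile transform of the
   law of the code of [Z n] is a good point for all [u <= P (Z n in G n)]. *)
Let enc n (z : R * R) : R := plane_code z + (if z \in G n then 0 else 2).
Let dec (c : R) : R * R := plane_decode (if c <= 1 then c else c - 2).

Let encK n : cancel (enc n) dec.
Proof.
move=> z; rewrite /enc /dec; have /andP[z0 z1] := plane_code_itv z.
case: (z \in G n); first by rewrite addr0 z1 plane_codeK.
by rewrite leNgt (_ : 1 < _) ?addrK ?plane_codeK//; lra.
Qed.

Let enc_le1 n z : (enc n z <= 1) = (z \in G n).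
Proof.
rewrite /enc; have /andP[z0 z1] := plane_code_itv z.
by case: ifPn => _; [rewrite addr0|apply/negbTE; rewrite -ltNge; lra].
Qed.

Let measurable_dec : measurable_fun setT dec.
Proof.
apply: measurableT_comp; first exact: measurable_plane_decode.
apply: measurable_fun_ifT => //; first exact: measurable_fun_ler.
exact: measurable_funB.
Qed.

Let measurable_encZ n : measurable_fun setT (enc n \o Z n).
Proof.
apply: measurableT_comp => //; apply: measurable_funD.
  exact: measurable_plane_code.
apply: measurable_fun_ifT => //; apply: (measurable_fun_bool true).
rewrite setTI (_ : _ @^-1` _ = G n)//.
by apply/seteqP; split => z /= => [/set_mem|/mem_set].
Qed.

Let K n : {RV (P n) >-> R} := mfun_Sub (mem_set (@measurable_encZ n)).

Let Zt n (u : W) : R * R := dec (quantile (K n) u).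

Let measurable_Zt n : measurable_fun setT (Zt n).
Proof. by apply: measurableT_comp => //; exact: measurable_quantile. Qed.

Let Q_Zt n (A : set R) : measurable A ->
  Q (quantile (K n) @^-1` A) = P n ((enc n \o Z n) @^-1` A).
Proof. exact: uniform_quantile. Qed.

Let law_Zt n (E : set (R * R)) : measurable E ->
  Q (Zt n @^-1` E) = P n (Z n @^-1` E).
Proof.
move=> mE; rewrite -[Zt n @^-1` E]/(quantile (K n) @^-1` (dec @^-1` E)) Q_Zt.
  by congr (P n _); apply/seteqP; split => w /=; rewrite encK.
by rewrite -[X in measurable X]setTI; exact: measurable_dec.
Qed.

Let ae_Q_filter : Filter (almost_everywhere Q).
Proof. exact: ae_filter_ringOfSetsType. Qed.

Let ae_Zt_G : {ae Q, forall u, \forall n \near \oo, G n (Zt n u)}.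
Proof.
have ae01 : {ae Q, forall u, u \in `]0, 1[%R}.
  apply/negligibleP; first exact: (measurableC (measurable_itv _)).
  rewrite /Q /= /uniform_prob integral_uniform_pdf; apply: null_set_integral.
  - exact: (measurableI _ _ (measurableC (measurable_itv _))).
  - by apply: measurable_funTS; apply/measurable_EFinP; exact: measurable_uniform_pdf.
  - apply: countable_lebesgue_measure0; apply: (@sub_countable _ _ _ [set 0; 1]).
      apply: subset_card_le => u [/= /negP + ]; rewrite !in_itv/= => + /andP[u0 u1].
      by rewrite negb_and -!leNgt => /orP[] ?; [left|right]; lra.
    exact: finite_set_countable.
(* A value at most 1 could decode to a bad point only outside the range of [enc n], and the law of
   the quantile transform gives no mass to such values. *)
have aeG : {ae Q, forall u, forall n, quantile (K n) u <= 1 -> G n (Zt n u)}.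
  apply: ae_foralln => n.
  have mE : measurable (dec @^-1` (~` G n)).
    by rewrite -[X in measurable X]setTI; apply: measurable_dec => //; exact: measurableC.
  have mI : measurable (`]-oo, 1] `&` dec @^-1` (~` G n)) by exact: measurableI.
  have : Q.-negligible (quantile (K n) @^-1` (`]-oo, 1] `&` dec @^-1` (~` G n))).
    apply/negligibleP.
      rewrite -[X in measurable X]setTI; exact: measurable_quantile.
    apply: (eq_trans (Q_Zt n mI)); rewrite (_ : _ @^-1` _ = set0) ?measure0//.
    apply/seteqP; split => // w /= [] /=; rewrite in_itv/= enc_le1 => /set_mem GZ.
    by rewrite encK.
  by apply: negligibleS => u /= /not_implyP[u1 nG]; split.
apply: (@filterS2 _ _ ae_Q_filter _ _ _ _ ae01 aeG) => u u01 uG.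
have PG' : (fun n => fine (P n (Z n @^-1` G n))) @ \oo --> (1 : R).
  exact/fine_cvg.
have u1 : u < 1 by move: u01; rewrite in_itv/= => /andP[].
apply: filterS (cvgr_gt _ PG' _ u1) => n un; apply: uG.
rewrite quantile_le//; apply: ltW; apply: (lt_le_trans un).
rewrite /cdf /distribution /pushforward/=.
rewrite (_ : _ @^-1` `]-oo, 1] = Z n @^-1` G n)//.
apply/seteqP; split => w /=; rewrite in_itv/= enc_le1; first exact: set_mem.
exact: mem_set.
Qed.

(** Both sequences are read off the same point [Zt n u], so a deterministic statement about
    sequences of points that are eventually good applies to almost every [u]. *)
Lemma equivalent_in_distribution_of_good_events
    (s t : nat -> R * R -> option R) :
  (forall n, partial_RV (s n)) -> (forall n, partial_RV (t n)) ->
  (forall z : nat -> R * R, (\forall n \near \oo, G n (z n)) ->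
    partial_equivalent (fun n => s n (z n)) (fun n => t n (z n))) ->
  equivalent_in_distribution P (fun n w => s n (Z n w)) (fun n w => t n (Z n w)).
Proof.
move=> ms mt st.
have same (r : nat -> R * R -> option R) : (forall n, partial_RV (r n)) ->
    forall n, same_distribution Q (P n) (r n \o Zt n) (fun w => r n (Z n w)).
  move=> mr n; split => B mB.
  - by have := @measurable_Zt n measurableT _ (mr n _ mB); rewrite setTI.
  - by have := @mZ n measurableT _ (mr n _ mB); rewrite setTI.
  - have := @law_Zt n _ (mr n _ mB). exact.
exists _, W, Q, (fun n => s n \o Zt n), (fun n => t n \o Zt n).
split; [exact: same|exact: same|].
by apply: (@filterS _ _ ae_Q_filter _ _ _ ae_Zt_G) => u; exact: st.
Qed.

End coupling.

(** * Expectation of a product of independent variables *)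

Lemma measure_prod_unique d1 d2 (T1 : measurableType d1) (T2 : measurableType d2)
    (R : realType) (m m' : {measure set (T1 * T2) -> \bar R}) :
  (m setT < +oo)%E ->
  (forall A B, measurable A -> measurable B -> m (A `*` B) = m' (A `*` B)) ->
  forall E, measurable E -> m E = m' E.
Proof.
move=> moo mm' E mE.
pose C : set (set (T1 * T2)) :=
  [set A `*` B | A in measurable & B in measurable].
apply: (measure_unique C (fun=> setT)) => //.
- by rewrite measurable_prod_measurableType.
- move=> _ _ [A1 mA1 [B1 mB1 <-]] [A2 mA2 [B2 mB2 <-]].
  exists (A1 `&` A2); first exact: measurableI.
  by exists (B1 `&` B2); [exact: measurableI|rewrite setXI].
- by move=> n; exists setT => //; exists setT => //; rewrite setXTT.
- by apply/seteqP; split => // z _; exists 0%N.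
- by move=> _ [A mA [B mB <-]]; exact: mm'.
Qed.

Definition independent2 d (T : measurableType d) (R : realType)
    (P : probability T R) (X Y : T -> R) : Prop :=
  forall A B : set R, measurable A -> measurable B ->
    (P (X @^-1` A `&` Y @^-1` B) = P (X @^-1` A) * P (Y @^-1` B))%E.

Section independent_expectation.
Context d (T : measurableType d) (R : realType) (P : probability T R).
Implicit Types X Y : T -> R.

Lemma independent2_comp X Y (f g : R -> R) :
  measurable_fun setT f -> measurable_fun setT g ->
  independent2 P X Y -> independent2 P (f \o X) (g \o Y).
Proof.
move=> mf mg XY A B mA mB.
rewrite -[(f \o X) @^-1` A]/(X @^-1` (f @^-1` A)).
rewrite -[(g \o Y) @^-1` B]/(Y @^-1` (g @^-1` B)) XY//.
  by rewrite -[X in measurable X]setTI; exact: mf.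
by rewrite -[X in measurable X]setTI; exact: mg.
Qed.

(** Independence says that the law of the pair is the product of the marginal laws. Tonelli gives
    integrability of the product, and Fubini then factors its integral. *)
Lemma independent2_integralM X Y :
  independent2 P X Y ->
  P.-integrable setT (EFin \o X) -> P.-integrable setT (EFin \o Y) ->
  P.-integrable setT (fun w => (X w * Y w)%:E) /\
  (\int[P]_w (X w * Y w) = (\int[P]_w X w) * (\int[P]_w Y w))%R.
Proof.
move=> XY iX iY.
have mX : measurable_fun setT X by apply/measurable_EFinP; exact: measurable_int iX.
have mY : measurable_fun setT Y by apply/measurable_EFinP; exact: measurable_int iY.
pose X' : {mfun T >-> R} := mfun_Sub (mem_set mX).
pose Y' : {mfun T >-> R} := mfun_Sub (mem_set mY).
pose mu1 : probability R R := distribution P X'.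
pose mu2 : probability R R := distribution P Y'.
pose XYf w := (X w, Y w).
have mXY : measurable_fun setT XYf by exact: measurable_fun_pair.
pose f (z : R * R) := (z.1 * z.2)%:E.
have mf : measurable_fun setT f by apply/measurable_EFinP; exact: measurable_funM.
have law E : measurable E -> (mu1 \x mu2)%E E = pushforward P XYf E.
  move=> mE; apply: product_measure_unique => // A B mA mB.
have i1 : mu1.-integrable setT (EFin : R -> \bar R).
  exact: (@integrable_pushforward _ _ _ _ _ _ mX).
have i2 : mu2.-integrable setT (EFin : R -> \bar R).
  exact: (@integrable_pushforward _ _ _ _ _ _ mY).
have int1 : (\int[mu1]_x x%:E = (\int[P]_w X w)%:E)%E.
  by rewrite (integral_pushforward mX)// fineK// integrable_fin_num.
have int2 : (\int[mu2]_x x%:E = (\int[P]_w Y w)%:E)%E.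
  by rewrite (integral_pushforward mY)// fineK// integrable_fin_num.
have ia1 : mu1.-integrable setT (fun x => `|x%:E|%E) := integrable_abse i1.
have ia2 : mu2.-integrable setT (fun x => `|x%:E|%E) := integrable_abse i2.
have if12 : (mu1 \x mu2)%E.-integrable setT f.
  apply/integrable12ltyP => //.
  have iabs2 := integrable_fin_num measurableT ia2.
  have fE x : (\int[mu2]_y `|f (x, y)| = `|x%:E| * \int[mu2]_y `|y%:E|)%E.
    rewrite -[X in (X * _)%E]/(`|x|%:E) -integralZl//; apply: eq_integral => y _.
    by rewrite /f/= normrM EFinM.
  rewrite (eq_integral _ _ (fun x _ => fE x)) -(fineK iabs2) integralZr//.
  rewrite fineK// -ge0_fin_numE; last by rewrite mule_ge0 ?integral_ge0.
  by rewrite fin_numM// integrable_fin_num.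
have if_ : (pushforward P XYf).-integrable setT f.
  apply/integrableP; split => //.
  rewrite (eq_measure_integral (mu1 \x mu2)%E); last by move=> E mE _; apply/esym; exact: law.
  by case/integrableP : if12.
have iP : P.-integrable setT (f \o XYf).
  apply/integrableP; split; first exact: measurableT_comp.
  have : (\int[pushforward P XYf]_z (abse \o f) z < +oo)%E by case/integrableP : if_.
  rewrite (ge0_integral_pushforward mXY)//; last by move=> z _; exact: abse_ge0.
  by apply: measurable_funTS; exact: measurableT_comp.
split; first exact: iP.
transitivity (fine (\int[pushforward P XYf]_z f z)%E).
  by rewrite (integral_pushforward mXY).
rewrite (eq_measure_integral (mu1 \x mu2)%E); last by move=> E mE _; apply/esym; exact: law.
rewrite -integral12_prod_meas1//=.
have fE x : (\int[mu2]_y f (x, y) = x%:E * (\int[P]_w Y w)%:E)%E.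
  rewrite -int2 -integralZl//; apply: eq_integral => y _.
by rewrite /fubini_F (eq_integral _ _ (fun x _ => fE x)) integralZr// int1.
Qed.
End independent_expectation.

(** * A partial sum is independent of the next summand *)

Section partial_sums.
Context d (T : measurableType d) (R : realType) (P : probability T R).
Variables (n : nat) (U : 'I_n -> T -> R).
Hypothesis mU : forall i, measurable_fun setT (U i).
Hypothesis indepU : mutually_independent P U.

(** The index stays in ['I_n] with a bound on its value, so that induction on [k] works with one
    fixed family. *)
Definition partial_sum (k : nat) (w : T) : R := \sum_(i < n | (i < k)%N) U i w.

Lemma partial_sum0 : partial_sum 0 = cst 0.
Proof. by apply/funext => w; rewrite /partial_sum big1. Qed.

Lemma partial_sumS (i : 'I_n) w :
  partial_sum i.+1 w = partial_sum i w + U i w.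
Proof.
rewrite /partial_sum (bigD1 i)//= addrC; congr (_ + _).
by apply: eq_bigl => j; rewrite ltnS ltn_neqAle andbC.
Qed.

Lemma partial_sum_full w : partial_sum n w = \sum_(i < n) U i w.
Proof. by apply: eq_bigl => i; rewrite ltn_ord. Qed.

Lemma measurable_partial_sum k : measurable_fun setT (partial_sum k).
Proof.
rewrite (_ : partial_sum k = fun w => \sum_(i < n) (if (i < k)%N then U i w else 0)).
  by apply: measurable_sum => i; case: (i < k)%N.
by apply/funext => w; rewrite /partial_sum big_mkcond.
Qed.

Let tail k : {set 'I_n} := [set i : 'I_n | (k <= i)%N].

Let cylinder k (B : 'I_n -> set R) : set T :=
  \bigcap_(i in [set` tail k]) (U i @^-1` B i).

Let measurable_cylinder k B : (forall i, measurable (B i)) ->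
  measurable (cylinder k B).
Proof.
move=> mB; apply: fin_bigcap_measurable; first exact: finite_finset.
by move=> i _; rewrite -[X in measurable X]setTI; exact: mU.
Qed.

Let cylinderS (i : 'I_n) B :
  cylinder i B = U i @^-1` B i `&` cylinder i.+1 B.
Proof.
apply/seteqP; split => [w Uw|w [Ui Uw] j /=].
  split; first by apply: Uw; rewrite /= inE.
  by move=> j /=; rewrite inE => /ltnW ij; apply: Uw; rewrite /= inE.
rewrite inE leq_eqVlt => /orP[/eqP/val_inj <-//|ij].
by apply: Uw; rewrite /= inE.
Qed.

(** The induction has to carry events on all the later variables jointly: independence of the sum
    from the next summand alone would not pass from [k] to [k.+1]. *)
Let partial_sum_cylinder k (A : set R) (B : 'I_n -> set R) : (k <= n)%N ->
  measurable A -> (forall i, measurable (B i)) ->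
  (P (partial_sum k @^-1` A `&` cylinder k B) =
   P (partial_sum k @^-1` A) * P (cylinder k B))%E.
Proof.
elim: k A B => [|k IH] A B kn mA mB.
  rewrite partial_sum0 preimage_cst; case: ifP => _.
    by rewrite setTI probability_setT mul1e.
  by rewrite set0I measure0 mul0e.
pose i := Ordinal kn.
have indep_i B' C : (forall i, measurable (B' i)) -> measurable C ->
    (P (U i @^-1` C `&` cylinder i.+1 B') = P (U i @^-1` C) * P (cylinder i.+1 B'))%E.
  move=> mB' mC.
  pose B'' j := if j == i then C else B' j.
  have mB'' j : measurable (B'' j) by rewrite /B''; case: ifP.
  have cyl : cylinder i.+1 B' = cylinder i.+1 B''.
    apply: eq_bigcapr => j /=; rewrite inE => ij.
    by rewrite /B''; case: eqP => // ji; rewrite ji ltnn in ij.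
  have -> : U i @^-1` C `&` cylinder i.+1 B' = cylinder i B''.
    by rewrite cylinderS -cyl /B'' eqxx.
  rewrite cyl /cylinder !indepU// (bigD1 i)/=; last by rewrite inE.
  rewrite /B'' eqxx; congr (_ * _)%E; apply: eq_bigl => j.
  by rewrite !inE ltn_neqAle andbC eq_sym.
have IHs A' C B' : measurable A' -> measurable C ->
    (forall i, measurable (B' i)) ->
    (P (partial_sum k @^-1` A' `&` (U i @^-1` C `&` cylinder i.+1 B')) =
    P (partial_sum k @^-1` A') * (P (U i @^-1` C) * P (cylinder i.+1 B')))%E.
  move=> mA' mC mB'; rewrite -indep_i//.
  pose B'' j := if j == i then C else B' j.
  have mB'' j : measurable (B'' j) by rewrite /B''; case: ifP.
  have -> : U i @^-1` C `&` cylinder i.+1 B' = cylinder k B''.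
    rewrite (cylinderS i) {1}/B'' eqxx; congr (_ `&` _).
    apply: eq_bigcapr => j /=; rewrite inE => ij.
    by rewrite /B''; case: eqP => // ji; rewrite ji ltnn in ij.
  exact: (IH _ _ (ltnW kn)).
have cylT : cylinder i.+1 (fun=> setT) = setT by apply/seteqP; split.
pose S w := (partial_sum k w, U i w).
have mS : measurable_fun setT S.
  by apply: measurable_fun_pair => //; exact: measurable_partial_sum.
have mC := measurable_cylinder i.+1 mB.
have c0 : 0 <= fine (P (cylinder i.+1 B)) by rewrite fine_ge0.
have cE : ((fine (P (cylinder i.+1 B)))%:E = P (cylinder i.+1 B))%E.
  by rewrite fineK// fin_num_measure.
(* With the tail event fixed, both sides are finite measures in the set of values of the pair
   (partial sum, next summand). They agree on rectangles by [IHs], hence also on [E], the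
   non-rectangular event that the sum of the pair falls in [A]. *)
pose m1 := pushforward (mrestr P mC) S.
pose S' : {mfun T >-> (R * R)%type} := mfun_Sub (mem_set mS).
pose m2 := mscale (NngNum c0) (distribution P S').
have m12 : forall E, measurable E -> m1 E = m2 E.
  apply: measure_prod_unique.
    change (P (S @^-1` setT `&` cylinder i.+1 B) < +oo)%E; rewrite preimage_setT setTI.
    by rewrite (le_lt_trans (probability_le1 _ _)) ?ltry.
  move=> A' C mA' mC'.
  change (P (S @^-1` (A' `*` C) `&` cylinder i.+1 B) =
    (fine (P (cylinder i.+1 B)))%:E * P (S @^-1` (A' `*` C)))%E; rewrite cE.
  rewrite (_ : S @^-1` _ = partial_sum k @^-1` A' `&` U i @^-1` C)//.
  rewrite -setIA IHs//.
  have := IHs A' C (fun=> setT) mA' mC'; rewrite cylT setIT => ->//.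
  by rewrite probability_setT mule1 muleA muleC.
pose E : set (R * R) := [set z | A (z.1 + z.2)].
have mE : measurable E.
  rewrite -[X in measurable X]setTI.
  by apply: (measurable_funD measurable_fst measurable_snd).
have : (P (S @^-1` E `&` cylinder i.+1 B) =
    (fine (P (cylinder i.+1 B)))%:E * P (S @^-1` E))%E by exact: m12.
rewrite cE.
rewrite (_ : S @^-1` _ = partial_sum k.+1 @^-1` A) => [->|]; first by rewrite muleC.
by apply/seteqP; split => w /=; rewrite (partial_sumS i).
Qed.

Lemma partial_sum_independent (i : 'I_n) :
  independent2 P (partial_sum i) (U i).
Proof.
move=> A B mA mB.
pose B' j := if j == i then B else setT.
have mB' j : measurable (B' j) by rewrite /B'; case: ifP.
have := partial_sum_cylinder (ltnW (ltn_ord i)) mA mB'.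
rewrite (_ : cylinder i B' = U i @^-1` B)//.
rewrite cylinderS /B' eqxx -[RHS]setIT; congr (_ `&` _).
apply/seteqP; split => // w _ j /=; rewrite inE.
by case: eqP => // ->; rewrite ltnn.
Qed.

End partial_sums.

(** * Taylor bounds for sine and cosine *)

Section trigo_bounds.
Context (R : realType).
Implicit Types x : R.

(** Mean value theorem. Each Taylor bound below integrates the previous one: the derivative of the
    new difference is the old difference. *)
Let ge0_of_derive_ge0 (f f' : R -> R) : f 0 = 0 ->
  (forall x, is_derive x 1 f (f' x)) -> (forall x, 0 <= x -> 0 <= f' x) ->
  forall x, 0 <= x -> 0 <= f x.
Proof.
move=> f0 df f'0 x; rewrite le_eqVlt => /predU1P[<-|x0]; first by rewrite f0.
have [//|c + fE] := MVT x0 (fun z _ => df z).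
  apply: derivable_within_continuous => z _; exact: ex_derive.
rewrite in_itv/= => /andP[/ltW c0 _].
by move: fE; rewrite f0 !subr0 => ->; apply: mulr_ge0; [exact: f'0|exact: ltW].
Qed.

Lemma sin_le_id x : 0 <= x -> sin x <= x.
Proof.
rewrite -[sin x <= x]subr_ge0.
apply: (ge0_of_derive_ge0 (f := fun z => z - sin z) (f' := fun z => 1 - cos z)).
- by rewrite sin0 subrr.
- by move=> z _; rewrite subr_ge0 cos_le1.
Qed.

Lemma cos_ge_taylor2 x : 1 - x ^+ 2 / 2 <= cos x.
Proof.
wlog x0 : x / 0 <= x.
  move=> h; have [|/ltW x0] := leP 0 x; first exact: h.
  by rewrite -cosN -(sqrrN x); apply: h; rewrite oppr_ge0.
rewrite -subr_ge0.
move: x x0; apply: (ge0_of_derive_ge0 (f := fun z => cos z - (1 - z ^+ 2 / 2))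
  (f' := fun z => z - sin z)).
- by rewrite cos0 expr0n/= mul0r subr0 subrr.
- move=> z /=; apply: is_derive_eq.
  rewrite /GRing.scale/=; lra.
- by move=> z z0; rewrite subr_ge0 sin_le_id.
Qed.

Lemma sin_ge_taylor3 x : 0 <= x -> x - x ^+ 3 / 6 <= sin x.
Proof.
rewrite -[_ <= sin x]subr_ge0.
apply: (ge0_of_derive_ge0 (f := fun z => sin z - (z - z ^+ 3 / 6))
  (f' := fun z => cos z - (1 - z ^+ 2 / 2))).
- by rewrite sin0 expr0n/= mul0r !subr0.
- move=> z /=; apply: is_derive_eq.
  rewrite /GRing.scale/=; lra.
- by move=> z _; rewrite subr_ge0 cos_ge_taylor2.
Qed.

Lemma cos_le_taylor4 x : cos x <= 1 - x ^+ 2 / 2 + x ^+ 4 / 24.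
Proof.
wlog x0 : x / 0 <= x.
  move=> h; have [|/ltW x0] := leP 0 x; first exact: h.
  rewrite -cosN -(sqrrN x) (_ : x ^+ 4 = (- x) ^+ 4); last by ring.
  by apply: h; rewrite oppr_ge0.
rewrite -subr_ge0.
move: x x0.
apply: (ge0_of_derive_ge0
  (f := fun z => 1 - z ^+ 2 / 2 + z ^+ 4 / 24 - cos z)
  (f' := fun z => sin z - (z - z ^+ 3 / 6))).
- by rewrite cos0 !expr0n/= !mul0r subr0 addr0 subrr.
- move=> z /=; apply: is_derive_eq.
  rewrite /GRing.scale/=; lra.
- by move=> z z0; rewrite subr_ge0 sin_ge_taylor3.
Qed.

(** Only third moments are available, so the quartic term is traded for a cubic one: it is smaller
    when [|x| <= 1], and otherwise the right-hand side is at least 1. *)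
Lemma cos_le_cubic x : cos x <= 1 - x ^+ 2 / 2 + `|x| ^+ 3 / 2.
Proof.
rewrite -cos_norm -(real_normK (num_real x)).
have := normr_ge0 x; move: `|x| => y y0.
have y3 : 0 <= y ^+ 3 by rewrite exprn_ge0.
have [y1|/ltW y1] := leP y 1.
  have := cos_le_taylor4 y.
  have : y ^+ 4 <= y ^+ 3 by rewrite exprSr ler_piMr.
  lra.
have : y ^+ 2 <= y ^+ 3 by rewrite [leRHS]exprSr ler_peMr ?sqr_ge0.
have := cos_le1 y; lra.
Qed.

Lemma sin_id_cubic x : `|sin x - x| <= `|x| ^+ 3 / 6.
Proof.
wlog x0 : x / 0 <= x.
  move=> h; have [|/ltW x0] := leP 0 x; first exact: h.
  by have := h (- x); rewrite oppr_ge0 normrN sinN opprK addrC distrC; exact.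
have := sin_le_id x0; have := sin_ge_taylor3 x0.
rewrite ler_norml (ger0_norm x0); lra.
Qed.

End trigo_bounds.

(** * Real-valued integrals and Markov's inequality *)

Section real_integrable.
Context d (T : measurableType d) (R : realType) (P : probability T R).
Implicit Types (f g : T -> R).

Definition real_integrable f := P.-integrable setT (EFin \o f).

Lemma real_integrableD f g : real_integrable f -> real_integrable g ->
  real_integrable (fun w => f w + g w).
Proof. by move=> fi gi; exact: (integrableD measurableT fi gi). Qed.

Lemma real_integrableB f g : real_integrable f -> real_integrable g ->
  real_integrable (fun w => f w - g w).
Proof. by move=> fi gi; exact: (integrableB measurableT fi gi). Qed.

Lemma real_integrableZl (k : R) f : real_integrable f ->
  real_integrable (fun w => k * f w).
Proof.
move=> fi; have := @integrableZl _ _ _ P _ measurableT k _ fi.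
by apply: eq_integrable => // w _ /=; rewrite EFinM.
Qed.

Lemma real_integrable_cst (k : R) : real_integrable (fun=> k).
Proof. exact: finite_measure_integrable_cst. Qed.

Lemma real_integrable_le f g : measurable_fun setT f ->
  (forall w, `|f w| <= g w) -> real_integrable g -> real_integrable f.
Proof.
move=> mf fg gi; apply: (le_integrable measurableT _ _ gi).
  exact/measurable_EFinP.
by move=> w _ /=; rewrite lee_fin (le_trans (fg w))// ler_norm.
Qed.

Lemma real_integrable_bounded f (k : R) : measurable_fun setT f ->
  (forall w, `|f w| <= k) -> real_integrable f.
Proof. by move=> mf fk; apply: (real_integrable_le mf fk); exact: real_integrable_cst. Qed.

Lemma measurable_real_integrable f : real_integrable f -> measurable_fun setT f.
Proof. by move=> fi; apply/measurable_EFinP; exact: measurable_int fi. Qed.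

Lemma real_integrable_sum (I : Type) (r : seq I) (F : I -> T -> R) :
  (forall i, real_integrable (F i)) -> real_integrable (fun w => \sum_(i <- r) F i w).
Proof.
move=> Fi; elim: r => [|i r IH].
  by under eq_fun do rewrite big_nil; exact: real_integrable_cst.
by under eq_fun do rewrite big_cons; exact: real_integrableD.
Qed.

Lemma Rintegral_sum (I : Type) (r : seq I) (F : I -> T -> R) :
  (forall i, real_integrable (F i)) ->
  \int[P]_w (\sum_(i <- r) F i w) = \sum_(i <- r) \int[P]_w F i w.
Proof.
move=> Fi; elim: r => [|i r IH].
  by rewrite big_nil; under eq_Rintegral do rewrite big_nil; rewrite Rintegral_cst// mul0r.
rewrite big_cons -IH -RintegralD//; [|exact: Fi|exact: real_integrable_sum].
by apply: eq_Rintegral => w _; rewrite big_cons.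
Qed.

Lemma Rintegral_prob_cst (k : R) : \int[P]_w k = k.
Proof.
rewrite Rintegral_cst//.
transitivity (k * fine (P setT)) => //.
by rewrite probability_setT mulr1.
Qed.

Lemma real_markov f (a : R) : real_integrable f -> (forall w, 0 <= f w) -> 0 < a ->
  fine (P [set w | a <= f w]) <= (\int[P]_w f w) / a.
Proof.
move=> fi f0 a0; have mf := measurable_real_integrable fi.
set A := [set w | a <= f w].
have mA : measurable A.
  rewrite -[X in measurable X]setTI.
  have mb : measurable_fun setT (fun w => a <= f w) by exact: measurable_fun_ler.
  exact: (mb measurableT [set true]).
rewrite ler_pdivlMr//.
rewrite (_ : fine _ = \int[P]_w (\1_A w)); last first.
  by rewrite /Rintegral integral_indic// setIT.
rewrite -RintegralZr//; last exact: integrable_indic.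
apply: le_Rintegral => //.
  apply: (@real_integrable_bounded _ `|a|).
    by apply: measurable_funM => //; exact: measurable_indic.
  by move=> w; rewrite normrM indicE; case: (w \in A); rewrite ?normr1 ?normr0 ?mul1r ?mul0r.
move=> w _; rewrite indicE; case: (boolP (w \in A)) => [/set_mem|_].
  by rewrite mul1r.
by rewrite mul0r.
Qed.

End real_integrable.

(** * Second moment and characteristic function of an independent sum *)

Section partial_sum_moments.
Context d (T : measurableType d) (R : realType) (P : probability T R).
Variables (n : nat) (U : 'I_n -> T -> R).
Hypothesis indepU : mutually_independent P U.

Section second_moment.
Hypothesis iU : forall i, real_integrable P (U i).
Hypothesis iU2 : forall i, real_integrable P (fun w => U i w ^+ 2).
Hypothesis U0 : forall i, \int[P]_w U i w = 0.

Lemma partial_sum_moments k : (k <= n)%N ->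
  [/\ real_integrable P (partial_sum U k),
      \int[P]_w partial_sum U k w = 0,
      real_integrable P (fun w => partial_sum U k w ^+ 2) &
      \int[P]_w (partial_sum U k w ^+ 2) =
        \sum_(i < n | (i < k)%N) \int[P]_w (U i w ^+ 2)].
Proof.
elim: k => [|k IH] kn.
  rewrite partial_sum0 big1//; split.
  - exact: real_integrable_cst.
  - exact: Rintegral_prob_cst.
  - exact: (real_integrable_cst P (0 ^+ 2)).
  - by rewrite (Rintegral_prob_cst P (0 ^+ 2)) expr0n.
have [iS S0 iS2 S2] := IH (ltnW kn).
pose i := Ordinal kn.
have mU j := measurable_real_integrable (iU j).
have [iSU SU] := independent2_integralM (partial_sum_independent mU indepU i) iS (iU i).
have SE : partial_sum U k.+1 = fun w => partial_sum U k w + U i w.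
  by apply/funext => w; exact: (partial_sumS U i).
have S2E : (fun w => partial_sum U k.+1 w ^+ 2) =
    fun w => (partial_sum U k w ^+ 2 + 2 * (partial_sum U k w * U i w)) + U i w ^+ 2.
  by apply/funext => w; rewrite SE; ring.
have i2 := real_integrableZl 2 iSU.
have i12 := real_integrableD iS2 i2.
split.
- by rewrite SE; exact: real_integrableD.
- by rewrite SE (RintegralD measurableT iS (iU i)) S0 U0 addr0.
- by rewrite S2E; exact: real_integrableD.
- rewrite S2E (RintegralD measurableT i12 (iU2 i)) (RintegralD measurableT iS2 i2).
  rewrite (RintegralZl 2 measurableT iSU) SU U0 !mulr0 addr0 S2.
  rewrite [RHS](bigD1 i)//= [RHS]addrC; congr (_ + _).
  by apply: eq_bigl => j; rewrite ltnS ltn_neqAle andbC.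
Qed.

Lemma sum_chebyshev (a : R) : 0 < a ->
  fine (P [set w | a <= `|\sum_(i < n) U i w|]) <=
  (\sum_(i < n) \int[P]_w (U i w ^+ 2)) / a ^+ 2.
Proof.
move=> a0; have [_ _ iS2 S2] := partial_sum_moments (leqnn n).
rewrite (_ : \sum_(i < n) _ = \sum_(i < n | (i < n)%N) \int[P]_w (U i w ^+ 2)).
  rewrite -S2 (_ : [set w | _] = [set w | a ^+ 2 <= partial_sum U n w ^+ 2]).
    by apply: real_markov => //; [move=> w; exact: sqr_ge0|exact: exprn_gt0].
  apply/seteqP; split => w /=; rewrite partial_sum_full -(real_normK (num_real (\sum_i _)));
    by rewrite ler_pXn2r// ?nnegrE// ltW.
by apply: eq_bigl => i; rewrite ltn_ord.
Qed.
End second_moment.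

Section characteristic.
Hypothesis mU : forall i, measurable_fun setT (U i).
Variables (theta s : R).

(** With [mean_sin], the real and imaginary parts of the characteristic function of [f] at [s]. *)
Definition mean_cos (f : T -> R) := \int[P]_w cos (s * f w).
Definition mean_sin (f : T -> R) := \int[P]_w sin (s * f w).

(** The phase [theta] will absorb the centre [y] of a small ball. It rotates the characteristic
    function without changing its modulus. *)
Let C k := \int[P]_w cos (theta + s * partial_sum U k w).
Let S k := \int[P]_w sin (theta + s * partial_sum U k w).

(** The squared modulus of a characteristic function is multiplicative over independent summands;
    the addition formulas for cosine and sine carry the complex product in real terms. *)
Lemma partial_sum_char k : (k <= n)%N ->
  C k ^+ 2 + S k ^+ 2 =
  \prod_(i < n | (i < k)%N) (mean_cos (U i) ^+ 2 + mean_sin (U i) ^+ 2).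
Proof.
elim: k => [|k IH] kn.
  have C0 : C 0 = cos theta.
    rewrite -[RHS](Rintegral_prob_cst P); apply: eq_Rintegral => w _.
    by rewrite partial_sum0 /= mulr0 addr0.
  have S0 : S 0 = sin theta.
    rewrite -[RHS](Rintegral_prob_cst P); apply: eq_Rintegral => w _.
    by rewrite partial_sum0 /= mulr0 addr0.
  by rewrite big1// C0 S0 cos2Dsin2.
pose i := Ordinal kn.
have iE := partial_sum_independent mU indepU i.
have maff t : measurable_fun setT (fun x : R => t + s * x).
  by apply: measurable_funD => //; exact: measurable_funM.
have mcos t : measurable_fun setT (fun x : R => cos (t + s * x)).
  apply: (measurableT_comp (f := @cos R)) => //.
  by apply: continuous_measurable_fun; exact: continuous_cos.
have msin t : measurable_fun setT (fun x : R => sin (t + s * x)).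
  apply: (measurableT_comp (f := @sin R)) => //.
  by apply: continuous_measurable_fun; exact: continuous_sin.
have mS := measurable_partial_sum mU k.
have ic t f : measurable_fun setT f -> real_integrable P (fun w => cos (t + s * f w)).
  move=> mf; apply: (@real_integrable_bounded _ _ _ _ _ 1).
    exact: (measurableT_comp (mcos t)).
  by move=> w; exact: cos_max.
have is_ t f : measurable_fun setT f -> real_integrable P (fun w => sin (t + s * f w)).
  move=> mf; apply: (@real_integrable_bounded _ _ _ _ _ 1).
    exact: (measurableT_comp (msin t)).
  by move=> w; exact: sin_max.
have [icc cc] := independent2_integralM (independent2_comp (mcos theta) (mcos 0) iE)
  (ic _ _ mS) (ic _ _ (mU i)).
have [ics cs] := independent2_integralM (independent2_comp (mcos theta) (msin 0) iE)
  (ic _ _ mS) (is_ _ _ (mU i)).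
have [isc sc] := independent2_integralM (independent2_comp (msin theta) (mcos 0) iE)
  (is_ _ _ mS) (ic _ _ (mU i)).
have [iss ss] := independent2_integralM (independent2_comp (msin theta) (msin 0) iE)
  (is_ _ _ mS) (is_ _ _ (mU i)).
have f0 : (\int[P]_w cos (0 + s * U i w) = mean_cos (U i))%R.
  by apply: eq_Rintegral => w _; rewrite add0r.
have g0 : (\int[P]_w sin (0 + s * U i w) = mean_sin (U i))%R.
  by apply: eq_Rintegral => w _; rewrite add0r.
have CE : C k.+1 = C k * mean_cos (U i) - S k * mean_sin (U i).
  rewrite -f0 -g0 -cc -ss -RintegralB//; apply: eq_Rintegral => w _ /=.
  by rewrite (partial_sumS U i) -cosD; congr cos; rewrite /=; ring.
have SE : S k.+1 = S k * mean_cos (U i) + C k * mean_sin (U i).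
  rewrite -f0 -g0 -cs -sc -RintegralD//; apply: eq_Rintegral => w _ /=.
  by rewrite (partial_sumS U i) -sinD; congr sin; rewrite /=; ring.
rewrite (bigD1 i)//= (eq_bigl (fun j : 'I_n => (j < k)%N)); last first.
  by move=> j; rewrite ltnS ltn_neqAle andbC.
by rewrite -IH ?(ltnW kn)// CE SE; ring.
Qed.

Lemma sum_mean_cos_le (r : R) :
  (forall i, mean_cos (U i) ^+ 2 + mean_sin (U i) ^+ 2 <= r) ->
  (\int[P]_w cos (theta + s * \sum_(i < n) U i w)) ^+ 2 <= r ^+ n.
Proof.
move=> hr.
rewrite (_ : \int[P]_w _ = C n); last first.
  by apply: eq_Rintegral => w _; rewrite partial_sum_full.
apply: (@le_trans _ _ (C n ^+ 2 + S n ^+ 2)); first by rewrite lerDl sqr_ge0.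
rewrite partial_sum_char// -[X in _ <= _ ^+ X]card_ord -prodr_const.
rewrite [leLHS](eq_bigl xpredT); last by move=> i; rewrite ltn_ord.
by apply: ler_prod => i _; rewrite hr addr_ge0 ?sqr_ge0.
Qed.
End characteristic.

End partial_sum_moments.

(** * Characteristic function of one centered variable near the origin *)

Lemma cube_normD_le (R : realFieldType) (x y : R) :
  `|x + y| ^+ 3 <= 4 * (`|x| ^+ 3 + `|y| ^+ 3).
Proof.
apply: (@le_trans _ _ ((`|x| + `|y|) ^+ 3)).
  by rewrite ler_pXn2r ?nnegrE ?addr_ge0// ler_normD.
have := normr_ge0 x; have := normr_ge0 y; move: `|x| `|y| => a b b0 a0.
rewrite -subr_ge0 (_ : _ - _ = 3 * ((a + b) * (a - b) ^+ 2)); last by ring.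
by rewrite mulr_ge0// mulr_ge0 ?sqr_ge0// addr_ge0.
Qed.

Lemma cube_norm_ge (R : realFieldType) (x : R) : `|x| <= 1 + `|x| ^+ 3.
Proof.
have := normr_ge0 x; move: `|x| => y y0.
have y3 : 0 <= y ^+ 3 by rewrite exprn_ge0.
have [y1|/ltW y1] := leP y 1; first by rewrite (le_trans y1)// lerDl.
by apply: (@le_trans _ _ (y ^+ 3)); [rewrite ler_eXnr|rewrite lerDr].
Qed.

Lemma sqr_le_cube_norm (R : realFieldType) (x : R) : x ^+ 2 <= 1 + `|x| ^+ 3.
Proof.
rewrite -(real_normK (num_real x)); have := normr_ge0 x; move: `|x| => y y0.
have y3 : 0 <= y ^+ 3 by rewrite exprn_ge0.
have [y1|/ltW y1] := leP y 1; first by rewrite (@le_trans _ _ 1) ?lerDl ?expr_le1.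
by rewrite (@le_trans _ _ (y ^+ 3)) ?lerDr// [leRHS]exprSr ler_peMr ?sqr_ge0.
Qed.

Section characteristic_bound.
Context d (T : measurableType d) (R : realType) (P : probability T R).

Lemma moment2_le_moment3 (f : T -> R) :
  real_integrable P (fun w => f w ^+ 2) ->
  real_integrable P (fun w => `|f w| ^+ 3) ->
  \int[P]_w (f w ^+ 2) <= 1 + \int[P]_w (`|f w| ^+ 3).
Proof.
move=> f2i f3i; have ic := real_integrable_cst P (1 : R).
rewrite -[X in X + _](Rintegral_prob_cst P) -RintegralD//.
apply: le_Rintegral => //; first exact: (real_integrableD ic f3i).
by move=> w _; exact: sqr_le_cube_norm.
Qed.

(** Second-order expansion with cubic error; the imaginary part is purely cubic because the mean is
    0. The bound on [|s| * M] makes the cubic error at most half of the quadratic term, and the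
    bound on [s ^+ 2] keeps the real part nonnegative, so that it can be squared. *)
Lemma mean_cos_sin_le (f : T -> R) (v M s : R) :
  real_integrable P f -> real_integrable P (fun w => f w ^+ 2) ->
  real_integrable P (fun w => `|f w| ^+ 3) ->
  \int[P]_w f w = 0 -> v <= \int[P]_w (f w ^+ 2) ->
  \int[P]_w (`|f w| ^+ 3) <= M -> 0 <= v ->
  `|s| * M <= v / 2 -> s ^+ 2 * (1 + M) <= 2 ->
  mean_cos P s f ^+ 2 + mean_sin P s f ^+ 2 <= 1 - s ^+ 2 * v / 8.
Proof.
move=> fi f2i f3i f0 vf fM v0 sM s2M.
have mf := measurable_real_integrable fi.
have msf : measurable_fun setT (fun w => s * f w) by exact: measurable_funM.
have ic : real_integrable P (fun w => cos (s * f w)).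
  apply: (@real_integrable_bounded _ _ _ _ _ 1); last by move=> w; exact: cos_max.
  apply: (measurableT_comp (f := @cos R)) => //.
  by apply: continuous_measurable_fun; exact: continuous_cos.
have is_ : real_integrable P (fun w => sin (s * f w)).
  apply: (@real_integrable_bounded _ _ _ _ _ 1); last by move=> w; exact: sin_max.
  apply: (measurableT_comp (f := @sin R)) => //.
  by apply: continuous_measurable_fun; exact: continuous_sin.
set c := mean_cos P s f; set g := mean_sin P s f.
set sg := \int[P]_w (f w ^+ 2) in vf *.
set m3 := \int[P]_w (`|f w| ^+ 3) in fM *.
have m30 : 0 <= m3 by apply: Rintegral_ge0 => w _; rewrite exprn_ge0.
have sg_le : sg <= 1 + m3 := moment2_le_moment3 f2i f3i.
have c_le : c <= 1 - s ^+ 2 * sg / 2 + `|s| ^+ 3 * m3 / 2.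
  have i1 := real_integrableZl (- (s ^+ 2 / 2)) f2i.
  have i2 := real_integrableZl (`|s| ^+ 3 / 2) f3i.
  have i3 := real_integrableD (real_integrable_cst P 1) i1.
  have -> : 1 - s ^+ 2 * sg / 2 + `|s| ^+ 3 * m3 / 2 =
     \int[P]_w (1 + - (s ^+ 2 / 2) * f w ^+ 2 + `|s| ^+ 3 / 2 * `|f w| ^+ 3).
    rewrite (RintegralD measurableT i3 i2).
    rewrite (RintegralD measurableT (real_integrable_cst P 1) i1).
    rewrite (RintegralZl _ measurableT f2i) (RintegralZl _ measurableT f3i).
    by rewrite Rintegral_prob_cst -/sg -/m3; ring.
  apply: le_Rintegral => //; first exact: (real_integrableD i3 i2).
  move=> w _; apply: (le_trans (cos_le_cubic _)).
  by rewrite normrM exprMn exprMn; lra.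
have c_ge : 1 - s ^+ 2 * sg / 2 <= c.
  have i1 := real_integrableZl (- (s ^+ 2 / 2)) f2i.
  have i3 := real_integrableD (real_integrable_cst P 1) i1.
  have -> : 1 - s ^+ 2 * sg / 2 = \int[P]_w (1 + - (s ^+ 2 / 2) * f w ^+ 2).
    rewrite (RintegralD measurableT (real_integrable_cst P 1) i1).
    rewrite (RintegralZl _ measurableT f2i).
    by rewrite Rintegral_prob_cst -/sg; ring.
  apply: le_Rintegral => // w _; apply: le_trans (cos_ge_taylor2 _).
  by rewrite exprMn; lra.
have g_le : `|g| <= `|s| ^+ 3 * m3 / 6.
  have i1 := real_integrableZl s fi.
  have i2 := real_integrableZl (`|s| ^+ 3 / 6) f3i.
  have isf := real_integrableB is_ i1.
  have -> : g = \int[P]_w (sin (s * f w) - s * f w).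
    by rewrite (RintegralB measurableT is_ i1) (RintegralZl s measurableT fi) f0 mulr0 subr0.
  have -> : `|s| ^+ 3 * m3 / 6 = \int[P]_w (`|s| ^+ 3 / 6 * `|f w| ^+ 3).
    by rewrite (RintegralZl _ measurableT f3i) -/m3; ring.
  apply: (le_trans (le_normr_Rintegral measurableT isf)).
  apply: le_Rintegral => //; first exact: integrable_norm.
  move=> w _; apply: (le_trans (sin_id_cubic _)).
  by rewrite normrM exprMn; lra.
have s2E : s ^+ 2 = `|s| ^+ 2 by rewrite real_normK// num_real.
have : 0 <= `|s| by []; move: c_le g_le sM; rewrite s2E in s2M c_ge *.
move: `|s| s2M c_ge => r s2M c_ge c_le g_le sM r0.
(* With [A <= 2], the real part lies between 0 and 1 - A/4 and the imaginary part is at most A/12,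
   so the squared modulus is at most 1 - A/4 + A/72, below 1 - A/8. *)
set A := r ^+ 2 * sg.
have sg0 : 0 <= sg by exact: le_trans vf.
have A0 : 0 <= A by rewrite mulr_ge0// sqr_ge0.
have A2 : A <= 2.
  by apply: le_trans s2M; rewrite ler_wpM2l ?sqr_ge0//; lra.
have B : r ^+ 3 * m3 <= A / 2.
  have rm : r * m3 <= sg / 2.
    apply: (@le_trans _ _ (r * M)); first by rewrite ler_wpM2l.
    by apply: (le_trans sM); rewrite ler_wpM2r ?invr_ge0.
  rewrite (_ : r ^+ 3 * m3 = r ^+ 2 * (r * m3)); last by ring.
  rewrite (_ : A / 2 = r ^+ 2 * (sg / 2)); last by rewrite /A; ring.
  by rewrite ler_wpM2l ?sqr_ge0.
have g2 : g ^+ 2 <= A / 72.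
  have gA : `|g| <= A / 12 by lra.
  rewrite -(real_normK (num_real g)).
  apply: (@le_trans _ _ ((A / 12) ^+ 2)).
    by rewrite ler_pXn2r ?nnegrE//; lra.
  nra.
have rv : r ^+ 2 * v <= A by rewrite ler_wpM2l ?sqr_ge0.
have c0 : 0 <= c by apply: le_trans c_ge; rewrite -/A; lra.
have c1 : c <= 1 - A / 4 by move: c_le; rewrite -/A; lra.
have c2 : c ^+ 2 <= 1 - A / 4.
  by apply: (le_trans _ c1); rewrite expr2 ler_piMl//; lra.
lra.
Qed.

End characteristic_bound.

(** * Anti-concentration of sums *)

Lemma bernoulli_exp_le (R : realType) (x : R) (n : nat) : 0 <= x <= 1 ->
  (1 - x) ^+ n * (1 + n%:R * x) <= 1.
Proof.
move=> /andP[x0 x1]; elim: n => [|n IH]; first by rewrite expr0 mul0r addr0 mulr1.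
apply: le_trans IH; rewrite exprSr -mulrA ler_wpM2l ?exprn_ge0 ?subr_ge0//.
rewrite -natr1; have : 0 <= (n%:R : R) by []; nra.
Qed.

Section concentration.
Context d (T : measurableType d) (R : realType) (P : probability T R).
Variables (n : nat) (U : 'I_n -> T -> R) (v M : R).
Hypothesis indepU : mutually_independent P U.
Hypothesis iU : forall i, real_integrable P (U i).
Hypothesis iU2 : forall i, real_integrable P (fun w => U i w ^+ 2).
Hypothesis iU3 : forall i, real_integrable P (fun w => `|U i w| ^+ 3).
Hypothesis U0 : forall i, \int[P]_w U i w = 0.
Hypothesis U2 : forall i, v <= \int[P]_w (U i w ^+ 2).
Hypothesis U3 : forall i, \int[P]_w (`|U i w| ^+ 3) <= M.
Hypothesis v0 : 0 < v.

Let mU i := measurable_real_integrable (iU i).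

(** The square of the left side is at most [(1 - x) ^+ n] with [x = s ^+ 2 * v / 8], hence at most 1
    / (1 + n x) by [bernoulli_exp_le]; the last hypothesis says that n x is at least 1 / kappa^2. *)
Lemma mean_cos_sum_le (theta s kappa : R) : 0 <= kappa ->
  `|s| * M <= v / 2 -> s ^+ 2 * (1 + M) <= 2 ->
  8 <= kappa ^+ 2 * (n%:R * (s ^+ 2 * v)) ->
  \int[P]_w cos (theta + s * \sum_(i < n) U i w) <= kappa.
Proof.
move=> k0 sM s2M hk.
have n0 : (0 < n)%N.
  rewrite lt0n; apply: contraTneq hk => n0.
  by rewrite -ltNge (_ : n%:R = 0 :> R) ?mul0r ?mulr0// n0.
pose i0 := Ordinal n0.
have v1 : v <= 1 + M.
  apply: (le_trans (U2 i0)); apply: (le_trans (moment2_le_moment3 (iU2 i0) (iU3 i0))).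
  by rewrite lerD2l.
have x01 : 0 <= s ^+ 2 * v / 8 <= 1.
  have : s ^+ 2 * v <= s ^+ 2 * (1 + M) by rewrite ler_wpM2l ?sqr_ge0.
  have : 0 <= s ^+ 2 * v by rewrite mulr_ge0 ?sqr_ge0 ?ltW.
  lra.
have := sum_mean_cos_le indepU mU theta (s := s) (r := 1 - s ^+ 2 * v / 8)
  (fun i => mean_cos_sin_le (iU i) (iU2 i) (iU3 i) (U0 i) (U2 i) (U3 i) (ltW v0) sM s2M).
set c := \int[P]_w _ => hc.
have [c0|c0] := leP c 0; first exact: le_trans k0.
rewrite -(@ler_pXn2r _ 2)// ?nnegrE ?(ltW c0)//.
apply: (le_trans hc).
have := bernoulli_exp_le n x01.
have : 8 / 8 <= kappa ^+ 2 * (1 + n%:R * (s ^+ 2 * v / 8)).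
  have : 0 <= kappa ^+ 2 by rewrite sqr_ge0.
  have -> : n%:R * (s ^+ 2 * v / 8) = n%:R * (s ^+ 2 * v) / 8 by ring.
  lra.
rewrite divff// => h1 h2.
have q0 : 0 < 1 + n%:R * (s ^+ 2 * v / 8).
  by case/andP : x01 => x0 _; rewrite ltr_pwDl// mulr_ge0.
by rewrite -(ler_pM2r q0) (le_trans h2).
Qed.

(* The indicator of [|b| <= delta] is at most [4 / m ^+ 2] times the squared modulus of
   [\sum_(j < m) e^(i j eta b)]; expanding the square, the [m] diagonal terms contribute
   [4 / m] and the other ones are values of the characteristic function. *)
Lemma concentration_function_le (m : nat) (eta y delta kappa : R) : (0 < m)%N -> 0 < eta ->
  0 <= kappa ->
  (m%:R * eta) * M <= v / 2 -> (m%:R * eta) ^+ 2 * (1 + M) <= 2 ->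
  8 <= kappa ^+ 2 * (n%:R * (eta ^+ 2 * v)) ->
  (m%:R * eta) * delta <= 1 ->
  fine (P [set w | `|\sum_(i < n) U i w - y| <= delta]) <=
    4 / m%:R + 4 * kappa.
Proof.
move=> m0 eta0 k0 h1 h2 h3 h4.
pose Y w := \sum_(i < n) U i w - y.
pose D w := \sum_(j < m) \sum_(k < m) cos ((j%:R - k%:R) * (eta * Y w)).
have DE w : D w = (\sum_(j < m) cos (j%:R * (eta * Y w))) ^+ 2 +
                  (\sum_(j < m) sin (j%:R * (eta * Y w))) ^+ 2.
  rewrite !expr2 !mulr_suml -big_split; apply: eq_bigr => j _ /=.
  rewrite !mulr_sumr -big_split; apply: eq_bigr => k _ /=.
  by rewrite mulrBl cosB.
have m0' : 0 < m%:R :> R by rewrite ltr0n.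
(* By [h4] every phase is at most 1 in absolute value, where the cosine is at least 1/2; the cosine
   sum alone already reaches m/2. *)
have D_ge w : `|Y w| <= delta -> (m%:R / 2) ^+ 2 <= D w.
  move=> Yd; rewrite DE.
  apply: (@le_trans _ _ ((\sum_(j < m) cos (j%:R * (eta * Y w))) ^+ 2)); last first.
    by rewrite lerDl sqr_ge0.
  have hs : m%:R / 2 <= \sum_(j < m) cos (j%:R * (eta * Y w)).
    rewrite (_ : m%:R / 2 = \sum_(j < m) 2^-1); last first.
      by rewrite sumr_const card_ord mulrC mulr_natr.
    apply: ler_sum => j _; apply: le_trans (cos_ge_taylor2 _).
    have jY : `|j%:R * (eta * Y w)| <= 1.
      apply: le_trans h4; rewrite !normrM (gtr0_norm eta0) normr_nat mulrA.
      rewrite ler_pM// ?mulr_ge0 ?(ltW eta0)//.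
      by rewrite ler_pM2r// ler_nat ltnW.
    rewrite -(real_normK (num_real _)); move: jY.
    have := normr_ge0 (j%:R * (eta * Y w)); move: `|_| => r; nra.
  by rewrite ler_pXn2r// nnegrE; [rewrite divr_ge0//|apply: le_trans hs; rewrite divr_ge0].
have D_ge0 w : 0 <= D w by rewrite DE addr_ge0 ?sqr_ge0.
have mY : measurable_fun setT Y.
  by apply: measurable_funB => //; exact: measurable_sum.
have icos (j k : nat) : real_integrable P (fun w => cos ((j%:R - k%:R) * (eta * Y w))).
  apply: (@real_integrable_bounded _ _ _ _ _ 1); last by move=> w; exact: cos_max.
  apply: (measurableT_comp (f := @cos R)).
    by apply: continuous_measurable_fun; exact: continuous_cos.
  by apply: measurable_funM => //; exact: measurable_funM.
have iD : real_integrable P D.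
  by apply: real_integrable_sum => j; apply: real_integrable_sum => k; exact: icos.
have ED : \int[P]_w D w <= m%:R + m%:R ^+ 2 * kappa.
  rewrite Rintegral_sum; last by move=> j; apply: real_integrable_sum => k; exact: icos.
  have -> : m%:R + m%:R ^+ 2 * kappa =
      \sum_(j < m) \sum_(k < m) ((j == k)%:R + kappa) :> R.
    under eq_bigr => j _.
      rewrite big_split/= sumr_const card_ord (bigD1 j)//= eqxx big1 ?addr0; last first.
        by move=> k /negbTE kj; rewrite eq_sym kj.
      over.
    by rewrite sumr_const card_ord -mulr_natr -[kappa *+ m]mulr_natr /=; ring.
  apply: ler_sum => j _; rewrite Rintegral_sum; last by move=> k; exact: icos.
  apply: ler_sum => k _; have [<-|jk] := eqVneq j k.
    rewrite (_ : \int[P]_w _ = 1) ?lerDl//.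
    rewrite -[RHS](Rintegral_prob_cst P); apply: eq_Rintegral => w _.
    by rewrite subrr mul0r cos0.
  rewrite add0r.
  (* [t] is a nonzero integer with [1 <= |t| <= m]. The upper bound keeps the frequency [t * eta] in
     the range of the expansion ([h1], [h2]); the lower bound keeps it away from the origin
     ([h3]). *)
  pose t : R := j%:R - k%:R.
  have dist (a b : nat) : (a < b < m)%N -> 1 <= (b%:R - a%:R : R) <= m%:R.
    move=> /andP[ab bm]; rewrite -natrB 1?ltnW// -[1]/(1%:R) !ler_nat; lia.
  have /andP[t1 tm] : 1 <= `|t| <= m%:R.
    have [jlk|klj|/val_inj/eqP] := ltngtP j k; last by rewrite (negbTE jk).
      by rewrite /t distrC ger0_norm ?subr_ge0 ?ler_nat 1?ltnW//;
        apply: dist; rewrite jlk ltn_ord.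
    by rewrite /t ger0_norm ?subr_ge0 ?ler_nat 1?ltnW//; apply: dist; rewrite klj ltn_ord.
  rewrite (_ : \int[P]_w _ =
      \int[P]_w cos (- (t * eta * y) + t * eta * \sum_(i < n) U i w)); last first.
    by apply: eq_Rintegral => w _; congr cos; rewrite /Y /t; ring.
  have n0 : (0 < n)%N.
    rewrite lt0n; apply: contraTneq h3 => n0.
    by rewrite -ltNge (_ : n%:R = 0 :> R) ?mul0r ?mulr0// n0.
  have M0 : 0 <= M.
    apply: le_trans (U3 (Ordinal n0)).
    by apply: Rintegral_ge0 => w _; rewrite exprn_ge0.
  apply: mean_cos_sum_le => //.
  - apply: le_trans h1; rewrite normrM (gtr0_norm eta0).
    by rewrite ler_wpM2r// ler_wpM2r// ltW.
  - apply: le_trans h2; rewrite ler_wpM2r//; first lra.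
    by rewrite exprMn [leRHS]exprMn ler_wpM2r ?sqr_ge0//
      -(real_normK (num_real t)) ler_pXn2r ?nnegrE.
  - apply: (le_trans h3); rewrite ler_wpM2l ?sqr_ge0// ler_wpM2l//.
    rewrite ler_wpM2r ?(ltW v0)// exprMn.
    by rewrite ler_peMl ?sqr_ge0// -(real_normK (num_real t)) exprn_ege1.
have m24 : 0 < (m%:R / 2) ^+ 2 :> R by rewrite exprn_gt0 ?divr_gt0.
apply: (@le_trans _ _ ((\int[P]_w D w) / (m%:R / 2) ^+ 2)); last first.
  rewrite ler_pdivrMr//; apply: (le_trans ED).
  by rewrite le_eqVlt; apply/orP; left; apply/eqP; field; rewrite gt_eqF.
apply: le_trans (real_markov iD D_ge0 m24).
have mYd (A : set R) : measurable A -> measurable (Y @^-1` A).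
  by move=> mA; rewrite -[X in measurable X]setTI; exact: mY.
have mE1 : measurable [set w | `|Y w| <= delta].
  rewrite (_ : [set w | _] = Y @^-1` `[- delta, delta]); first exact: mYd.
  by apply/seteqP; split => w /=; rewrite in_itv/= ler_norml.
have mE2 : measurable [set w | (m%:R / 2) ^+ 2 <= D w].
  have mb : measurable_fun setT (fun w => (m%:R / 2) ^+ 2 <= D w).
    by apply: measurable_fun_ler => //; exact: measurable_real_integrable iD.
  by rewrite -[X in measurable X]setTI; exact: (mb measurableT [set true]).
rewrite fine_le ?fin_num_measure// le_measure ?inE// => w /=; exact: D_ge.
Qed.
End concentration.

(** The order of quantifiers is the point: [delta] and [n0] depend only on [v], [M] and [e], not on
    the row, its law or the centre [y]. *)
Lemma small_ball (R : realType) (v M e : R) : 0 < v -> 0 <= M -> 0 < e ->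
  exists2 delta : R, 0 < delta & exists n0 : nat,
  forall (n : nat) d (T : measurableType d) (P : probability T R)
    (U : 'I_n -> T -> R) (y : R), (n0 <= n)%N ->
  mutually_independent P U ->
  (forall i, real_integrable P (U i)) ->
  (forall i, real_integrable P (fun w => U i w ^+ 2)) ->
  (forall i, real_integrable P (fun w => `|U i w| ^+ 3)) ->
  (forall i, \int[P]_w U i w = 0) ->
  (forall i, v <= \int[P]_w (U i w ^+ 2)) ->
  (forall i, \int[P]_w (`|U i w| ^+ 3) <= M) ->
  fine (P [set w | `|(Num.sqrt n%:R)^-1 * (\sum_(i < n) U i w) - y| <= delta]) <= e.
Proof.
move=> v0 M0 e0.
(* [4 * k] and [4 / m] each use half of [e]. [H] turns the third frequency condition into an
   equality at [eta = H / sqrt n], and the radius [1 / (m H)] does the same for the fourth. *)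
pose k := e / 8.
have k0 : 0 < k by rewrite divr_gt0.
pose m := (Num.truncn (8 / e)).+1.
have m0 : 0 < m%:R :> R by rewrite ltr0n.
have me : 4 / m%:R <= e / 2.
  have : 8 / e < m%:R by rewrite truncnS_gt.
  rewrite ltr_pdivrMr// => /ltW h.
  by rewrite ler_pdivrMr//; lra.
pose H := Num.sqrt (8 / (v * k ^+ 2)).
have vk0 : 0 < v * k ^+ 2 by rewrite mulr_gt0// exprn_gt0.
have H2 : H ^+ 2 = 8 / (v * k ^+ 2) by rewrite sqr_sqrtr// divr_ge0// ltW.
have H0 : 0 < H by rewrite sqrtr_gt0 divr_gt0.
(* The two summands are the thresholds on [n] beyond which [m * eta] meets the first and the second
   frequency condition. *)
pose q := (m%:R * H * M * 2 / v) ^+ 2 + (m%:R * H) ^+ 2 * (1 + M) / 2.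
exists (m%:R * H)^-1; first by rewrite invr_gt0 mulr_gt0.
exists (Num.truncn q).+1 => n d T P U y nn0 iU U1 U2 U3 Uc Uv UM.
have qn : q < n%:R by apply: (lt_le_trans (truncnS_gt q)); rewrite ler_nat.
have q1 : 0 <= (m%:R * H * M * 2 / v) ^+ 2 by rewrite sqr_ge0.
have q2 : 0 <= (m%:R * H) ^+ 2 * (1 + M) / 2.
  by rewrite divr_ge0// mulr_ge0 ?sqr_ge0// addr_ge0.
have n0 : 0 < n%:R :> R by apply: le_lt_trans qn; rewrite addr_ge0.
set r := Num.sqrt n%:R.
have r0 : 0 < r by rewrite sqrtr_gt0.
have r2 : r ^+ 2 = n%:R by rewrite sqr_sqrtr// ltW.
have rV0 : 0 < r^-1 by rewrite invr_gt0.
have rN0 : r != 0 by rewrite gt_eqF.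
pose eta := H / r.
have hr1 : m%:R * H * M * 2 / v <= r.
  rewrite -(@ler_pXn2r _ 2)// ?nnegrE ?(ltW r0)//; last first.
    by rewrite divr_ge0 ?(ltW v0)// !mulr_ge0// ltW.
  by rewrite r2; move: qn; rewrite /q; lra.
have := @concentration_function_le _ T R P n U v M iU U1 U2 U3 Uc Uv UM v0 m eta (y * r)
  ((m%:R * H)^-1 * r) k.
have -> : [set w | `|\sum_(i < n) U i w - y * r| <= (m%:R * H)^-1 * r] =
  [set w | `|r^-1 * (\sum_(i < n) U i w) - y| <= (m%:R * H)^-1].
  apply/eq_set => w.
  have -> : r^-1 * (\sum_(i < n) U i w) - y = r^-1 * (\sum_(i < n) U i w - y * r).
    by field.
  by rewrite normrM (gtr0_norm rV0) ler_pdivrMl// [r * _]mulrC.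
move=> h; apply: (@le_trans _ _ (4 / m%:R + 4 * k)); last by rewrite /k; lra.
apply: h.
- by rewrite -(ltr_nat R).
- by rewrite divr_gt0.
- exact: ltW.
- rewrite /eta mulrA mulrAC ler_pdivrMr//.
  move: hr1; rewrite ler_pdivrMr//; lra.
- rewrite /eta mulrA [(_ / r) ^+ 2]expr_div_n r2 mulrAC ler_pdivrMr//.
  by move: qn; rewrite /q; lra.
- rewrite /eta [(_ / r) ^+ 2]expr_div_n r2 H2 le_eqVlt; apply/orP; left; apply/eqP.
  by field; rewrite !gt_eqF.
- rewrite /eta le_eqVlt; apply/orP; left; apply/eqP.
  by field; rewrite rN0 !gt_eqF.
Qed.

(** * Moments of linear combinations of the scaled coordinates of a sample *)

Lemma measurable_invr (R : realType) : measurable_fun setT (@GRing.inv R).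
Proof.
rewrite -(setUv [set (0 : R)]); apply/measurable_funU => //.
  exact: measurableC.
split; first exact: measurable_fun_set1.
apply: subspace_continuous_measurable_fun; first exact: measurableC.
apply: continuous_in_subspaceT => x; rewrite inE/= => /eqP x0.
exact: inv_continuous.
Qed.

Lemma mutually_independent_comp d (T : measurableType d) d1 (T1 : measurableType d1)
    d2 (T2 : measurableType d2) (R : realType) (P : probability T R) (I : finType)
    (Z : I -> T -> T1) (h : T1 -> T2) : measurable_fun setT h ->
  mutually_independent P Z -> mutually_independent P (fun i => h \o Z i).
Proof.
move=> mh indZ J A mA; apply: (indZ J (fun i => h @^-1` A i)) => i.
by rewrite -[X in measurable X]setTI; exact: mh.
Qed.

Lemma real_integrable_eq_law d (T : measurableType d) d1 (T1 : measurableType d1)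
    (R : realType) (P : probability T R) (Z Z' : T -> T1) (h : T1 -> R) :
  measurable_fun setT Z -> measurable_fun setT Z' -> measurable_fun setT h ->
  (forall A, measurable A -> P (Z @^-1` A) = P (Z' @^-1` A)) ->
  real_integrable P (h \o Z) ->
  real_integrable P (h \o Z') /\ \int[P]_w h (Z' w) = \int[P]_w h (Z w).
Proof.
move=> mZ mZ' mh law iZ.
have mhE : measurable_fun setT (EFin \o h) by exact/measurable_EFinP.
have iE (f : T1 -> \bar R) :
    (\int[pushforward P Z]_x f x = \int[pushforward P Z']_x f x)%E.
  by apply: eq_measure_integral => A mA _; exact: law.
have i1 : (pushforward P Z').-integrable setT (EFin \o h).
  apply/integrableP; split => //.
  rewrite -iE; have : (pushforward P Z).-integrable setT (EFin \o h).
    exact: integrable_pushforward.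
  by case/integrableP.
have i2 : real_integrable P (h \o Z').
  apply/integrableP; split.
    by apply/measurable_EFinP; exact: measurableT_comp.
  have : (\int[pushforward P Z']_x `|(h x)%:E| < +oo)%E by case/integrableP : i1.
  rewrite (ge0_integral_pushforward mZ')//.
  by apply: measurable_funTS; exact: measurableT_comp.
split => //.
rewrite /Rintegral; congr fine.
have -> : (\int[P]_w (h (Z' w))%:E = \int[pushforward P Z']_x (h x)%:E)%E.
  by rewrite (integral_pushforward mZ').
by rewrite -iE (integral_pushforward mZ).
Qed.
Section sample.
Context d (T : measurableType d) (R : realType) (P : probability T R) (n : nat).
Variables (X Y : 'I_n.+1 -> {RV P >-> R}) (mu : probability (R * R)%type R).
Variables (gX gY K : R).
Hypothesis iid : iid_with_law P mu (fun i w => (X i w, Y i w)).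
Hypotheses (gX0 : 0 < gX) (gY0 : 0 < gY).
Hypothesis K3 : ('E_P[fun w => (`|X ord0 w| ^+ 3 * gX ^+ 3
  + `|Y ord0 w| ^+ 3 * gY ^+ 3)%R] <= K%:E)%E.

Let EX : R := fine ('E_P[X ord0])%E.
Let EY : R := fine ('E_P[Y ord0])%E.
(** An integrable envelope: up to constants it dominates the first three powers of both scaled
    coordinates, so every moment bound below comes from [K]. *)
Let F w : R := `|X ord0 w| ^+ 3 * gX ^+ 3 + `|Y ord0 w| ^+ 3 * gY ^+ 3.

Let FE w : F w = `|gX * X ord0 w| ^+ 3 + `|gY * Y ord0 w| ^+ 3.
Proof.
by rewrite !normrM (gtr0_norm gX0) (gtr0_norm gY0) /F; ring.
Qed.

Let F0 w : 0 <= F w.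
Proof. by rewrite FE addr_ge0// exprn_ge0. Qed.

Let mF : measurable_fun setT F.
Proof.
by apply: measurable_funD; apply: measurable_funM => //;
  apply: measurable_funX; exact: measurableT_comp.
Qed.

Let iF : real_integrable P F.
Proof.
apply/integrableP; split; first exact/measurable_EFinP.
apply: le_lt_trans (ltry K); apply: le_trans K3; rewrite unlock.
rewrite le_eqVlt; apply/orP; left; apply/eqP; apply: eq_integral => w _.
by rewrite /= ger0_norm.
Qed.

Let EF : \int[P]_w F w <= K.
Proof.
rewrite -lee_fin /Rintegral fineK; last exact: integrable_fin_num iF.
by move: K3; rewrite unlock.
Qed.

Let iX : real_integrable P (fun w => gX * X ord0 w).
Proof.
apply: (real_integrable_le (g := fun w => 1 + F w)).
- exact: measurable_funM.
- move=> w; apply: (le_trans (cube_norm_ge _)); rewrite FE lerD2l lerDl exprn_ge0//.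
- exact: real_integrableD (real_integrable_cst P 1) iF.
Qed.

Let iY : real_integrable P (fun w => gY * Y ord0 w).
Proof.
apply: (real_integrable_le (g := fun w => 1 + F w)).
- exact: measurable_funM.
- move=> w; apply: (le_trans (cube_norm_ge _)); rewrite FE lerD2l lerDr exprn_ge0//.
- exact: real_integrableD (real_integrable_cst P 1) iF.
Qed.

Let EXE : \int[P]_w (gX * X ord0 w) = gX * EX.
Proof.
have i0 : real_integrable P (X ord0).
  have := real_integrableZl gX^-1 iX; congr real_integrable; apply/funext => w.
  by rewrite mulKf// gt_eqF.
by rewrite (RintegralZl gX measurableT i0) /EX unlock.
Qed.

Lemma sample_snd_integrable : real_integrable P (Y ord0).
Proof.
have := real_integrableZl gY^-1 iY; congr real_integrable; apply/funext => w.
by rewrite mulKf// gt_eqF.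
Qed.

Let EYE : \int[P]_w (gY * Y ord0 w) = gY * EY.
Proof.
by rewrite (RintegralZl gY measurableT sample_snd_integrable) /EY unlock.
Qed.

Let i1F := real_integrableD (real_integrable_cst P 1) iF.

Let E1F : \int[P]_w (1 + F w) <= 1 + K.
Proof.
by rewrite (RintegralD measurableT (real_integrable_cst P 1) iF) Rintegral_prob_cst lerD2l.
Qed.

Let EX_le : `|gX * EX| <= 1 + K.
Proof.
rewrite -EXE; apply: le_trans E1F; apply: (le_trans (le_normr_Rintegral measurableT iX)).
apply: le_Rintegral => //; first exact: integrable_norm.
by move=> w _; apply: (le_trans (cube_norm_ge _)); rewrite FE lerD2l lerDl exprn_ge0.
Qed.

Let EY_le : `|gY * EY| <= 1 + K.
Proof.
rewrite -EYE; apply: le_trans E1F; apply: (le_trans (le_normr_Rintegral measurableT iY)).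
apply: le_Rintegral => //; first exact: integrable_norm.
by move=> w _; apply: (le_trans (cube_norm_ge _)); rewrite FE lerD2l lerDr exprn_ge0.
Qed.

Definition scaled_covariance : 'M[R]_2 := covariance_matrix P
  (fun (i : 'I_2) w => if i == 0 then gX * X ord0 w else gY * Y ord0 w).

Let cX w := gX * (X ord0 w - EX).
Let cY w := gY * (Y ord0 w - EY).

(** The dominating function comes from |fg| <= (f^2 + g^2) / 2 and x^2 <= 1 + |x|^3. *)
Let icc (f g : T -> R) (k : R) : measurable_fun setT f -> measurable_fun setT g ->
  (forall w, `|f w| ^+ 3 <= 4 * (F w + k)) ->
  (forall w, `|g w| ^+ 3 <= 4 * (F w + k)) ->
  real_integrable P (fun w => f w * g w).
Proof.
move=> mf mg fk gk.
have iFk := real_integrableD iF (real_integrable_cst P k).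
apply: (real_integrable_le _ _ (real_integrableD (real_integrable_cst P 2)
  (real_integrableZl 8 iFk))); first exact: measurable_funM.
move=> w; have := sqr_le_cube_norm (f w); have := sqr_le_cube_norm (g w).
have := fk w; have := gk w.
have := sqr_ge0 (f w - g w); have := sqr_ge0 (f w + g w).
rewrite ler_norml; nra.
Qed.

Let mcX : measurable_fun setT cX.
Proof. by apply: measurable_funM => //; exact: measurable_funB. Qed.

Let mcY : measurable_fun setT cY.
Proof. by apply: measurable_funM => //; exact: measurable_funB. Qed.

Let K1_ge0 : 0 <= 1 + K.
Proof. exact: le_trans EX_le. Qed.

Let cX3 w : `|cX w| ^+ 3 <= 4 * (F w + (1 + K) ^+ 3).
Proof.
rewrite /cX mulrBr; apply: (le_trans (cube_normD_le _ _)); rewrite ler_pM2l//.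
apply: lerD; first by rewrite FE lerDl exprn_ge0.
by rewrite normrN ler_pXn2r.
Qed.

Let cY3 w : `|cY w| ^+ 3 <= 4 * (F w + (1 + K) ^+ 3).
Proof.
rewrite /cY mulrBr; apply: (le_trans (cube_normD_le _ _)); rewrite ler_pM2l//.
apply: lerD; first by rewrite FE lerDr exprn_ge0.
by rewrite normrN ler_pXn2r.
Qed.

Let cov_entries :
  [/\ scaled_covariance 0 0 = \int[P]_w (cX w * cX w),
      scaled_covariance 0 1 = \int[P]_w (cX w * cY w) &
      scaled_covariance 1 1 = \int[P]_w (cY w * cY w)].
Proof.
have EXe : fine ('E_P[fun w => (gX * X ord0 w)%R])%E = gX * EX.
  by rewrite -EXE unlock.
have EYe : fine ('E_P[fun w => (gY * Y ord0 w)%R])%E = gY * EY.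
  by rewrite -EYE unlock.
rewrite /scaled_covariance; split; rewrite mxE/= !covariance.unlock ?EXe ?EYe;
  rewrite expectation.unlock; congr fine; apply: eq_integral => w _;
  by rewrite /cX/cY !mulrBr.
Qed.

Variables a b : R.
Hypotheses (a1 : `|a| <= 1) (b1 : `|b| <= 1).

(** Projecting on a direction [(a, b)] reduces the planar array to the scalar bounds on sums. *)
Definition centered_combination (i : 'I_n.+1) (w : T) : R :=
  a * (gX * (X i w - EX)) + b * (gY * (Y i w - EY)).
Local Notation U := centered_combination.

Let u (z : R * R) : R := a * (gX * (z.1 - EX)) + b * (gY * (z.2 - EY)).

Let mu_ : measurable_fun setT u.
Proof.
by apply: measurable_funD; apply: measurable_funM => //; apply: measurable_funM => //;
  apply: measurable_funB.
Qed.

Lemma centered_combination_indep : mutually_independent P U.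
Proof.
exact: (mutually_independent_comp mu_ iid.2).
Qed.

(** Two uses of [cube_normD_le]: 16 = 4 * 4 for the coordinates, and 32 = 4 * 4 * 2 for the two
    means, each bounded by [1 + K]. *)
Definition centered_moment3_bound : R := 16 * K + 32 * (1 + K) ^+ 3.

Let U3_le w : `|U ord0 w| ^+ 3 <= 16 * F w + 32 * (1 + K) ^+ 3.
Proof.
have -> : U ord0 w = (a * (gX * X ord0 w) + b * (gY * Y ord0 w)) +
    - (a * (gX * EX) + b * (gY * EY)) by rewrite /U; ring.
have c3 (c x y : R) : `|c| <= 1 -> `|x| <= y -> `|c * x| ^+ 3 <= y ^+ 3.
  move=> c1 xy; rewrite ler_pXn2r ?nnegrE ?(le_trans (normr_ge0 x) xy)//.
  by rewrite normrM (le_trans _ xy)// ler_piMl.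
have h1 := c3 a _ _ a1 (lexx `|gX * X ord0 w|).
have h2 := c3 b _ _ b1 (lexx `|gY * Y ord0 w|).
have h3 := c3 a _ _ a1 EX_le.
have h4 := c3 b _ _ b1 EY_le.
have := cube_normD_le (a * (gX * X ord0 w) + b * (gY * Y ord0 w))
  (- (a * (gX * EX) + b * (gY * EY))).
have := cube_normD_le (a * (gX * X ord0 w)) (b * (gY * Y ord0 w)).
have := cube_normD_le (a * (gX * EX)) (b * (gY * EY)).
rewrite normrN FE; lra.
Qed.

Let iUF : real_integrable P (fun w => 16 * F w + 32 * (1 + K) ^+ 3).
Proof.
exact: real_integrableD (real_integrableZl 16 iF) (real_integrable_cst P _).
Qed.

Let mZ (i : 'I_n.+1) : measurable_fun setT (fun w => (X i w, Y i w)).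
Proof. exact: measurable_fun_pair. Qed.

Let lawZ (i : 'I_n.+1) (A : set (R * R)) : measurable A ->
  P ((fun w => (X ord0 w, Y ord0 w)) @^-1` A) = P ((fun w => (X i w, Y i w)) @^-1` A).
Proof. by move=> mA; rewrite !iid.1. Qed.

Let mU0 : measurable_fun setT (U ord0).
Proof. exact: (measurableT_comp mu_ (mZ ord0)). Qed.

Let i3 : real_integrable P (fun w => `|U ord0 w| ^+ 3).
Proof.
apply: (real_integrable_le _ _ iUF).
  by apply: measurable_funX; exact: measurableT_comp.
by move=> w; rewrite ger0_norm ?exprn_ge0.
Qed.

Lemma centered_combination_integrable i : real_integrable P (U i).
Proof.
have i0 : real_integrable P (u \o (fun w => (X ord0 w, Y ord0 w))).
  apply: (real_integrable_le mU0 _ (real_integrableD (real_integrable_cst P 1) i3)).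
  by move=> w; exact: cube_norm_ge.
by have [] := real_integrable_eq_law (mZ ord0) (mZ i) mu_ (@lawZ i) i0.
Qed.

Lemma centered_combination_integral i : \int[P]_w U i w = 0.
Proof.
have [_ ->] := real_integrable_eq_law (mZ ord0) (mZ i) mu_ (@lawZ i)
  (centered_combination_integrable ord0).
have -> : (fun w => u (X ord0 w, Y ord0 w)) =
    (fun w => (a * (gX * X ord0 w) + b * (gY * Y ord0 w)) - (a * (gX * EX) + b * (gY * EY))).
  by apply/funext => w; rewrite /u/=; ring.
have ia := real_integrableZl a iX; have ib := real_integrableZl b iY.
rewrite (RintegralB measurableT (real_integrableD ia ib) (real_integrable_cst P _)).
rewrite (RintegralD measurableT ia ib) (RintegralZl a measurableT iX).
by rewrite (RintegralZl b measurableT iY) EXE EYE Rintegral_prob_cst subrr.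
Qed.

Let m2 : measurable_fun setT (fun z => u z ^+ 2).
Proof. exact: measurable_funX. Qed.

Let i2 : real_integrable P ((fun z => u z ^+ 2) \o (fun w => (X ord0 w, Y ord0 w))).
Proof.
apply: (real_integrable_le _ _ (real_integrableD (real_integrable_cst P 1) i3)).
  by apply: measurable_funX; exact: mU0.
by move=> w; rewrite ger0_norm ?sqr_ge0//; exact: sqr_le_cube_norm.
Qed.

Lemma centered_combination_integrable2 i : real_integrable P (fun w => U i w ^+ 2).
Proof. by have [] := real_integrable_eq_law (mZ ord0) (mZ i) m2 (@lawZ i) i2. Qed.

Lemma centered_combination_integral2 i :
  \int[P]_w (U i w ^+ 2) = \int[P]_w (U ord0 w ^+ 2).
Proof. by have [] := real_integrable_eq_law (mZ ord0) (mZ i) m2 (@lawZ i) i2. Qed.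

Let m3 : measurable_fun setT (fun z => `|u z| ^+ 3).
Proof. by apply: measurable_funX; exact: measurableT_comp. Qed.

Lemma centered_combination_integrable3 i : real_integrable P (fun w => `|U i w| ^+ 3).
Proof. by have [] := real_integrable_eq_law (mZ ord0) (mZ i) m3 (@lawZ i) i3. Qed.

Lemma centered_combination_integral3 i :
  \int[P]_w (`|U i w| ^+ 3) <= centered_moment3_bound.
Proof.
have [_ ->] := real_integrable_eq_law (mZ ord0) (mZ i) m3 (@lawZ i) i3.
apply: (@le_trans _ _ (\int[P]_w (16 * F w + 32 * (1 + K) ^+ 3))).
  by apply: le_Rintegral => // w _; exact: U3_le.
rewrite (RintegralD measurableT (real_integrableZl 16 iF) (real_integrable_cst P _)).
by rewrite (RintegralZl 16 measurableT iF) Rintegral_prob_cst lerD2r ler_pM2l.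
Qed.

Lemma centered_combination_variance :
  \int[P]_w (U ord0 w ^+ 2) = a ^+ 2 * scaled_covariance 0 0 +
    2 * a * b * scaled_covariance 0 1 + b ^+ 2 * scaled_covariance 1 1.
Proof.
have [-> -> ->] := cov_entries.
have iXX := icc mcX mcX cX3 cX3; have iXY := icc mcX mcY cX3 cY3.
have iYY := icc mcY mcY cY3 cY3.
have j1 := real_integrableZl (a ^+ 2) iXX.
have j2 := real_integrableZl (2 * a * b) iXY.
have j3 := real_integrableZl (b ^+ 2) iYY.
rewrite -(RintegralZl (a ^+ 2) measurableT iXX).
rewrite -(RintegralZl (2 * a * b) measurableT iXY).
rewrite -(RintegralZl (b ^+ 2) measurableT iYY).
rewrite -(RintegralD measurableT j1 j2).
rewrite -(RintegralD measurableT (real_integrableD j1 j2) j3).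
by apply: eq_Rintegral => w _; rewrite /U /cX /cY -/EX -/EY; ring.
Qed.

End sample.

(** * Uniform bounds on the variance over unit directions *)

Lemma quadratic_form2 (R : comRingType) (V : 'M[R]_2) (a b : R) (v : 'rV[R]_2) :
  v 0 0 = a -> v 0 1 = b ->
  (v *m V *m v^T) 0 0 =
    a ^+ 2 * V 0 0 + a * b * (V 0 1 + V 1 0) + b ^+ 2 * V 1 1.
Proof.
move=> <- <-; rewrite !mxE !big_ord_recl big_ord0 !mxE !big_ord_recl !big_ord0.
rewrite (_ : lift ord0 ord0 = 1)//; last exact: val_inj.
by rewrite (_ : ord0 = 0)//; ring.
Qed.

Lemma positive_definite2 (R : realType) (V : 'M[R]_2) : positive_definite V ->
  [/\ V 1 0 = V 0 1, 0 < V 0 0, 0 < V 1 1 & V 0 1 ^+ 2 < V 0 0 * V 1 1].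
Proof.
move=> [VT Vpos].
have sym : V 1 0 = V 0 1 by rewrite -[in LHS]VT mxE.
have pos (a b : R) : (a != 0) || (b != 0) ->
    0 < a ^+ 2 * V 0 0 + a * b * (V 0 1 + V 1 0) + b ^+ 2 * V 1 1.
  move=> ab; pose v : 'rV[R]_2 := \row_j (if j == 0 then a else b).
  have va : v 0 0 = a by rewrite mxE.
  have vb : v 0 1 = b by rewrite mxE.
  rewrite -(quadratic_form2 V va vb); apply: Vpos.
  apply: contraTneq ab => v0.
  by rewrite -va -vb v0 !mxE eqxx.
have V0 : 0 < V 0 0 by have := pos 1 0; rewrite oner_eq0 => /(_ isT); lra.
have V1 : 0 < V 1 1 by have := pos 0 1; rewrite oner_eq0 orbT => /(_ isT); lra.
split => //.
(* On this vector the form equals [V 0 0] times the determinant. *)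
have := pos (- V 0 1) (V 0 0); rewrite (gt_eqF V0) orbT => /(_ isT).
rewrite sym (_ : _ + _ = V 0 0 * (V 0 0 * V 1 1 - V 0 1 ^+ 2)); last by ring.
by rewrite pmulr_rgt0// subr_gt0.
Qed.

(* The smallest eigenvalue is at least the quotient of the determinant by the trace. *)
Lemma quadratic_form_lower (R : realFieldType) (p q r a b : R) : 0 < p -> 0 < r ->
  a ^+ 2 + b ^+ 2 = 1 ->
  (p * r - q ^+ 2) / (p + r) <= a ^+ 2 * p + 2 * a * b * q + b ^+ 2 * r.
Proof.
move=> p0 r0 ab; rewrite ler_pdivrMr ?addr_gt0// -subr_ge0.
(* Cayley-Hamilton: for a symmetric S and a unit vector v, |S v|^2 = (tr S) (v S v) - det S. *)
rewrite (_ : _ - _ = (a * p + b * q) ^+ 2 + (a * q + b * r) ^+ 2).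
  by rewrite addr_ge0 ?sqr_ge0.
have -> : p * r - q ^+ 2 = (a ^+ 2 + b ^+ 2) * (p * r - q ^+ 2) by rewrite ab mul1r.
by ring.
Qed.

Lemma covariance_bounds (R : realType) (S : nat -> 'M[R]_2) (V : 'M[R]_2) :
  positive_definite V -> S @ \oo --> V ->
  exists v w : R, [/\ 0 < v, 0 < w & \forall n \near \oo, forall a b : R,
    a ^+ 2 + b ^+ 2 = 1 ->
    v <= a ^+ 2 * S n 0 0 + 2 * a * b * S n 0 1 + b ^+ 2 * S n 1 1 <= w].
Proof.
move=> /positive_definite2[sym V0 V1 detV] SV.
pose D := (V 0 0 * V 1 1 - V 0 1 ^+ 2) / (V 0 0 + V 1 1).
have D0 : 0 < D by rewrite divr_gt0 ?subr_gt0 ?addr_gt0.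
have S_ij i j : (fun n => S n i j) @ \oo --> V i j.
  apply: (cvg_comp S (fun M : 'M[R]_2 => M i j) SV); exact: coord_continuous.
exists (D / 2), (V 0 0 + 2 * `|V 0 1| + V 1 1 + D / 2); split.
- by rewrite divr_gt0.
- by have := normr_ge0 (V 0 1); lra.
have D8 : 0 < D / 8 by rewrite divr_gt0.
(* The coefficients a^2, 2ab and b^2 are at most 1 in absolute value, so entrywise errors below D/8
   move the form by at most 3D/8, less than the margin D/2. *)
have near_ij i j : \forall n \near \oo, `|V i j - S n i j| < D / 8.
  by move/cvgrPdist_lt : (S_ij i j); exact.
near=> n => a b ab.
have h00 : `|V 0 0 - S n 0 0| < D / 8.
  by near: n; exact: near_ij.
have h01 : `|V 0 1 - S n 0 1| < D / 8.
  by near: n; exact: near_ij.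
have h11 : `|V 1 1 - S n 1 1| < D / 8.
  by near: n; exact: near_ij.
have := @quadratic_form_lower _ _ (V 0 1) _ a b V0 V1 ab; rewrite -/D.
have a2 : 0 <= a ^+ 2 <= 1 by rewrite sqr_ge0 -ab lerDl sqr_ge0.
have b2 : 0 <= b ^+ 2 <= 1 by rewrite sqr_ge0 -ab lerDr sqr_ge0.
have ab2 : `|2 * a * b| <= 1.
  by rewrite ler_norml; have := sqr_ge0 (a - b); have := sqr_ge0 (a + b); nra.
have k1 : `|a ^+ 2 * (V 0 0 - S n 0 0)| <= D / 8.
  rewrite normrM (ger0_norm (sqr_ge0 a)); apply: le_trans (ltW h00).
  by rewrite ler_piMl//; case/andP : a2.
have k2 : `|2 * a * b * (V 0 1 - S n 0 1)| <= D / 8.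
  by rewrite normrM; apply: le_trans (ltW h01); rewrite ler_piMl.
have k3 : `|b ^+ 2 * (V 1 1 - S n 1 1)| <= D / 8.
  rewrite normrM (ger0_norm (sqr_ge0 b)); apply: le_trans (ltW h11).
  by rewrite ler_piMl//; case/andP : b2.
have u1 : a ^+ 2 * V 0 0 <= V 0 0 by rewrite ler_piMl ?(ltW V0)//; case/andP : a2.
have u3 : b ^+ 2 * V 1 1 <= V 1 1 by rewrite ler_piMl ?(ltW V1)//; case/andP : b2.
have u2 : `|2 * a * b * V 0 1| <= `|V 0 1| by rewrite normrM ler_piMl.
move: k1 k2 k3 u2 (normr_ge0 (V 0 1)).
move: D0; rewrite !ler_norml; move: `|V 0 1| => z; lra.
Unshelve. all: by end_near. Qed.

(** * Partially defined variables and a criterion for their equivalence *)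

Lemma partial_RV_defined_if d (T : measurableType d) (R : realType)
    (c : T -> bool) (x : T -> R) :
  measurable_fun setT c -> measurable_fun setT x ->
  partial_RV (fun z => defined_if (c z) (x z)).
Proof.
move=> mc mx B mB.
rewrite (_ : _ @^-1` _ = c @^-1` [set true] `&` x @^-1` B).
  apply: measurableI; rewrite -[X in measurable X]setTI; first exact: mc.
  exact: mx.
apply/seteqP; split => z /=; rewrite /defined_if.
  by case: (c z) => -[y By] // [<-].
by move=> [-> Bx]; exists (x z).
Qed.

(** The ratio is stated as a product, so that nothing has to be assumed about zeros of [y]. *)
Lemma partial_equivalent_ratio (R : realType) (s t : nat -> option R) (x y rho : nat -> R) :
  (\forall n \near \oo, [/\ s n = Some (x n), t n = Some (y n) & x n = y n * rho n]) ->
  rho @ \oo --> (1 : R) ->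
  partial_equivalent s t.
Proof.
move=> st rho1; split.
  by apply: filterS st => n [-> ->].
apply/eqaddoP => e e0.
near=> n.
have [sn tn xy] : [/\ s n = Some (x n), t n = Some (y n) & x n = y n * rho n].
  by near: n.
rewrite /= !fctE sn tn/= xy -[X in _ - X]mulr1 -mulrBr normrM mulrC.
rewrite ler_wpM2r// distrC; apply: ltW.
near: n; move/cvgrPdist_lt : rho1; exact.
Unshelve. all: by end_near. Qed.

(** * The triangular array and the three regimes *)

Section triangular_array.
Context (R : realType) (d : nat -> measure_display)
  (Omega : forall n : nat, measurableType (d n))
  (P : forall n : nat, probability (Omega n) R)
  (X Y : forall n : nat, 'I_n.+1 -> {RV (P n) >-> R})
  (PXY : nat -> probability (R * R)%type R)
  (gammaX gammaY : nat -> R) (V : 'M[R]_2) (K : R).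
Arguments X : clear implicits.
Arguments Y : clear implicits.
Hypothesis iid : forall n, iid_with_law (P n) (PXY n)
  (fun (i : 'I_n.+1) (w : Omega n) => (X n i w, Y n i w)).
Hypothesis gammaX0 : forall n, 0 < gammaX n.
Hypothesis gammaY0 : forall n, 0 < gammaY n.
Hypothesis Vpos : positive_definite V.
Hypothesis cov_cvg : (fun n => covariance_matrix (P n) (fun (i : 'I_2) (w : Omega n) =>
  if i == 0 then gammaX n * X n ord0 w else gammaY n * Y n ord0 w)) @ \oo --> V.
Hypothesis K3 : forall n, ('E_(P n)[fun w : Omega n =>
  (`|X n ord0 w| ^+ 3 * gammaX n ^+ 3 + `|Y n ord0 w| ^+ 3 * gammaY n ^+ 3)%R] <= K%:E)%E.

Let EX n : R := fine ('E_(P n)[X n ord0])%E.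
Let EY n : R := fine ('E_(P n)[Y n ord0])%E.
Let sqrtN n : R := Num.sqrt n.+1%:R.

Definition sample_means n (w : Omega n) : R * R :=
  (empirical_mean (X n) w, empirical_mean (Y n) w).

Definition fluctuation_fst n (z : R * R) : R := sqrtN n * gammaX n * (z.1 - EX n).
Definition fluctuation_snd n (z : R * R) : R := sqrtN n * gammaY n * (z.2 - EY n).
Local Notation A := fluctuation_fst.
Local Notation B := fluctuation_snd.

Lemma sqrtN_gt0 n : 0 < sqrtN n.
Proof. by rewrite sqrtr_gt0. Qed.

Lemma sqr_sqrtN n : sqrtN n ^+ 2 = n.+1%:R.
Proof. by rewrite sqr_sqrtr. Qed.

Lemma measurable_sample_means n : measurable_fun setT (@sample_means n).
Proof.
by apply: measurable_fun_pair; apply: measurable_funM => //; exact: measurable_sum.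
Qed.

Lemma measurable_fluctuation_fst n : measurable_fun setT (A n).
Proof. by apply: measurable_funM => //; exact: measurable_funB. Qed.

Lemma measurable_fluctuation_snd n : measurable_fun setT (B n).
Proof. by apply: measurable_funM => //; exact: measurable_funB. Qed.

Lemma fluctuationE (a b : R) n w :
  a * A n (sample_means w) + b * B n (sample_means w) =
  (sqrtN n)^-1 * \sum_(i < n.+1)
     centered_combination (X n) (Y n) (gammaX n) (gammaY n) a b i w.
Proof.
have rt0 : sqrtN n != 0 by rewrite gt_eqF// sqrtN_gt0.
have sumE (Z : 'I_n.+1 -> R) (c : R) :
    \sum_(i < n.+1) (Z i - c) = \sum_(i < n.+1) Z i - sqrtN n ^+ 2 * c.
  by rewrite sumrB sumr_const card_ord sqr_sqrtN mulr_natl.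
rewrite /centered_combination big_split/= -!mulr_sumr !sumE.
rewrite /A /B /sample_means /empirical_mean /= -sqr_sqrtN -/(EX n) -/(EY n).
move: (\sum_(i < n.+1) X n i w) (\sum_(i < n.+1) Y n i w) => SX SY.
by field.
Qed.

Let unit_le1 (a b : R) : a ^+ 2 + b ^+ 2 = 1 -> `|a| <= 1 /\ `|b| <= 1.
Proof.
move=> ab; rewrite -(@expr_le1 _ 2 `|a|)// -(@expr_le1 _ 2 `|b|)//.
rewrite !real_normK ?num_real//.
by have := sqr_ge0 a; have := sqr_ge0 b; split; lra.
Qed.

Lemma fluctuation_small_ball (a b y delta : nat -> R) :
  (forall n, a n ^+ 2 + b n ^+ 2 = 1) -> delta @ \oo --> (0 : R) ->
  (fun n => fine (P n [set w | `|a n * A n (sample_means w) +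
     b n * B n (sample_means w) - y n| <= delta n])) @ \oo --> (0 : R).
Proof.
move=> ab delta0.
have [v [w [v0 w0 vw]]] := covariance_bounds Vpos cov_cvg.
have M0 : 0 <= centered_moment3_bound K.
  have [a1 b1] := unit_le1 (ab 0).
  apply: le_trans (centered_combination_integral3 (@iid 0) (gammaX0 0) (gammaY0 0) (@K3 0)
    a1 b1 ord0).
  by apply: Rintegral_ge0 => ? _; rewrite exprn_ge0.
apply/cvgrPdist_le => e e0.
have [D D0 [n0 hD]] := small_ball v0 M0 e0.
near=> n.
rewrite sub0r normrN ger0_norm ?fine_ge0//.
have dn : delta n <= D.
  have : `|0 - delta n| <= D by near: n; move/cvgrPdist_le : delta0; exact.
  by rewrite sub0r normrN; apply: le_trans; exact: ler_norm.
have [a1 b1] := unit_le1 (ab n).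
pose U := centered_combination (X n) (Y n) (gammaX n) (gammaY n) (a n) (b n).
have vn : v <= \int[P n]_w (U ord0 w ^+ 2).
  rewrite (centered_combination_variance (gammaX0 n) (gammaY0 n) (@K3 n)).
  have : forall a b : R, a ^+ 2 + b ^+ 2 = 1 -> v <=
      a ^+ 2 * scaled_covariance (X n) (Y n) (gammaX n) (gammaY n) 0 0 +
      2 * a * b * scaled_covariance (X n) (Y n) (gammaX n) (gammaY n) 0 1 +
      b ^+ 2 * scaled_covariance (X n) (Y n) (gammaX n) (gammaY n) 1 1 <= w.
    by near: n.
  by move=> /(_ (a n) (b n) (ab n)) /andP[].
have n0n : (n0 <= n.+1)%N by apply: leqW; near: n; exact: nbhs_infty_ge.
have := hD n.+1 _ _ (P n) U (y n) n0n.
move=> /(_ (centered_combination_indep _ _ (@iid n) _ _)).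
move=> /(_ (centered_combination_integrable (@iid n) (gammaX0 n) (gammaY0 n) (@K3 n) a1 b1)).
move=> /(_ (centered_combination_integrable2 (@iid n) (gammaX0 n) (gammaY0 n) (@K3 n) a1 b1)).
move=> /(_ (centered_combination_integrable3 (@iid n) (gammaX0 n) (gammaY0 n) (@K3 n) a1 b1)).
move=> /(_ (centered_combination_integral (@iid n) (gammaX0 n) (gammaY0 n) (@K3 n) a1 b1)).
move=> /(_ _ (centered_combination_integral3 (@iid n) (gammaX0 n) (gammaY0 n) (@K3 n) a1 b1)).
have vU i : v <= \int[P n]_w (U i w ^+ 2).
  by rewrite (centered_combination_integral2 (@iid n) (gammaX0 n) (gammaY0 n) (@K3 n) a1 b1).
move=> /(_ vU); apply: le_trans.
have mL : measurable_fun setT (fun w : Omega n =>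
    a n * A n (sample_means w) + b n * B n (sample_means w)).
  have mA := measurableT_comp (@measurable_fluctuation_fst n) (@measurable_sample_means n).
  have mB := measurableT_comp (@measurable_fluctuation_snd n) (@measurable_sample_means n).
  by apply: measurable_funD; apply: measurable_funM.
have mE (t : R) : measurable [set w : Omega n | `|a n * A n (sample_means w) +
    b n * B n (sample_means w) - y n| <= t].
  rewrite -[X in measurable X]setTI.
  have mb : measurable_fun setT (fun w : Omega n => `|a n * A n (sample_means w) +
    b n * B n (sample_means w) - y n| <= t).
    by apply: measurable_fun_ler => //; apply: measurableT_comp => //; exact: measurable_funB.
  exact: (mb measurableT [set true]).
have -> : [set w | `|(Num.sqrt n.+1%:R)^-1 * (\sum_(i < n.+1) U i w) - y n| <= D] =
    [set w : Omega n | `|a n * A n (sample_means w) +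
    b n * B n (sample_means w) - y n| <= D].
  by apply/eq_set => z; rewrite fluctuationE.
rewrite fine_le ?fin_num_measure// le_measure ?inE// => z /= h.
exact: le_trans dn.
Unshelve. all: by end_near. Qed.

Lemma fluctuation_tight (a b tau : nat -> R) :
  (forall n, a n ^+ 2 + b n ^+ 2 = 1) -> tau @ \oo --> +oo ->
  (fun n => fine (P n [set w | tau n <= `|a n * A n (sample_means w) +
     b n * B n (sample_means w)|])) @ \oo --> (0 : R).
Proof.
move=> ab tauoo.
have [v [w [v0 w0 vw]]] := covariance_bounds Vpos cov_cvg.
have tau_ge t : \forall n \near \oo, t <= tau n by move/cvgryPge : tauoo; exact.
apply/cvgrPdist_le => e e0.
near=> n.
rewrite sub0r normrN ger0_norm ?fine_ge0//.
have [a1 b1] := unit_le1 (ab n).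
(* This gives [tau n <= tau n ^+ 2], so that [w / e <= tau n] suffices in Chebyshev's bound. *)
have tn1 : 1 <= tau n by near: n; exact: tau_ge.
have tnw : w / e <= tau n by near: n; exact: tau_ge.
pose U := centered_combination (X n) (Y n) (gammaX n) (gammaY n) (a n) (b n).
have vn : \int[P n]_w (U ord0 w ^+ 2) <= w.
  rewrite (centered_combination_variance (gammaX0 n) (gammaY0 n) (@K3 n)).
  have : forall a b : R, a ^+ 2 + b ^+ 2 = 1 -> v <=
      a ^+ 2 * scaled_covariance (X n) (Y n) (gammaX n) (gammaY n) 0 0 +
      2 * a * b * scaled_covariance (X n) (Y n) (gammaX n) (gammaY n) 0 1 +
      b ^+ 2 * scaled_covariance (X n) (Y n) (gammaX n) (gammaY n) 1 1 <= w.
    by near: n.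
  by move=> /(_ (a n) (b n) (ab n)) /andP[].
have s0 : 0 < tau n * sqrtN n by rewrite mulr_gt0 ?sqrtN_gt0// (lt_le_trans ltr01).
have := sum_chebyshev (centered_combination_indep _ _ (@iid n) (a n) (b n))
  (centered_combination_integrable (@iid n) (gammaX0 n) (gammaY0 n) (@K3 n) a1 b1)
  (centered_combination_integrable2 (@iid n) (gammaX0 n) (gammaY0 n) (@K3 n) a1 b1)
  (centered_combination_integral (@iid n) (gammaX0 n) (gammaY0 n) (@K3 n) a1 b1) s0.
rewrite -/U.
have -> : [set w | tau n * sqrtN n <= `|\sum_(i < n.+1) U i w|] =
  [set w : Omega n | tau n <= `|a n * A n (sample_means w) + b n * B n (sample_means w)|].
  apply/eq_set => z; rewrite fluctuationE normrM normfV (gtr0_norm (sqrtN_gt0 n)).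
  by rewrite ler_pdivlMl ?sqrtN_gt0// [tau n * _]mulrC.
move=> /le_trans; apply.
rewrite ler_pdivrMr ?exprn_gt0//.
rewrite (eq_bigr (fun=> \int[P n]_w (U ord0 w ^+ 2))); last first.
  move=> i _.
  exact: (centered_combination_integral2 (@iid n) (gammaX0 n) (gammaY0 n) (@K3 n) a1 b1).
rewrite sumr_const card_ord -mulr_natr exprMn sqr_sqrtN mulrA ler_pM2r//.
apply: (le_trans vn); move: tnw; rewrite ler_pdivrMr// => h; apply: (le_trans h).
by rewrite mulrC ler_pM2l// ler_eXnr.
Unshelve. all: by end_near. Qed.


Hypothesis EY0 : forall n, (0 < 'E_(P n)[Y n ord0])%E.

Lemma mean_snd_gt0 n : 0 < EY n.
Proof.
have iY := sample_snd_integrable (gammaX0 n) (gammaY0 n) (@K3 n).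
rewrite -lte_fin /EY fineK// unlock; exact: integrable_fin_num iY.
Qed.

(** Removes probability from the rest: each regime reduces to choosing bad sets of vanishing mass
    and studying deterministic sequences that eventually avoid them. *)
Lemma sampling_equivalent (bad : nat -> set (R * R)) (s t : nat -> R * R -> option R) :
  (forall n, measurable (bad n)) ->
  (fun n => fine (P n (@sample_means n @^-1` bad n))) @ \oo --> (0 : R) ->
  (forall n, partial_RV (s n)) -> (forall n, partial_RV (t n)) ->
  (forall z : nat -> R * R, (\forall n \near \oo, ~ bad n (z n)) ->
    partial_equivalent (fun n => s n (z n)) (fun n => t n (z n))) ->
  equivalent_in_distribution P (fun n w => s n (sample_means w))
    (fun n w => t n (sample_means w)).
Proof.
move=> mbad bad0 ms mt st.
apply: (equivalent_in_distribution_of_good_events measurable_sample_means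
  (fun n => measurableC (mbad n))) => //.
have mpre n : measurable (@sample_means n @^-1` bad n).
  by rewrite -[X in measurable X]setTI; exact: measurable_sample_means.
have PE n : P n (@sample_means n @^-1` ~` bad n) =
    (1 - fine (P n (@sample_means n @^-1` bad n)))%:E.
  rewrite EFinB fineK ?fin_num_measure// -probability_setC//.
rewrite (funext PE) -[1%E]/((1 : R)%:E) -[X in _ --> X%:E]subr0.
by apply: cvg_EFin; [exact: nearW|apply: cvgB => //; exact: cvg_cst].
Qed.

Definition centered_ratio n (z : R * R) : option R :=
  defined_if (z.2 != 0) (sqrtN n * (z.1 / z.2 - EX n / EY n)).

Let mfst : measurable_fun [set: R * R] (@fst R R) := measurable_fst.
Let msnd : measurable_fun [set: R * R] (@snd R R) := measurable_snd.

Let mneq0 (x : R * R -> R) : measurable_fun setT x ->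
  measurable_fun setT (fun z => x z != 0).
Proof.
by move=> mx; apply: measurable_neg; exact: measurable_fun_eqr.
Qed.

Let mdiv (x y : R * R -> R) : measurable_fun setT x -> measurable_fun setT y ->
  measurable_fun setT (fun z => x z / y z).
Proof.
move=> mx my; apply: measurable_funM => //.
exact: (measurableT_comp (@measurable_invr R)).
Qed.

Lemma partial_RV_centered_ratio n : partial_RV (centered_ratio n).
Proof.
apply: partial_RV_defined_if; first exact: mneq0.
by apply: measurable_funM => //; apply: measurable_funB => //; exact: mdiv.
Qed.

Let t n : R := sqrtN n * gammaY n * EY n.

Let t0 n : 0 < t n.
Proof. by rewrite !mulr_gt0 ?sqrtN_gt0 ?mean_snd_gt0. Qed.

Let rtN0 n : sqrtN n != 0. Proof. by rewrite gt_eqF ?sqrtN_gt0. Qed.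
Let gX0 n : gammaX n != 0. Proof. by rewrite gt_eqF. Qed.
Let gY0 n : gammaY n != 0. Proof. by rewrite gt_eqF. Qed.
Let EYN0 n : EY n != 0. Proof. by rewrite gt_eqF ?mean_snd_gt0. Qed.

Let cvg_to1 (q err : nat -> R) : (\forall n \near \oo, `|q n - 1| <= err n) ->
  err @ \oo --> (0 : R) -> q @ \oo --> (1 : R).
Proof.
move=> qe e0; apply/cvgrPdist_le => e e_gt0; near=> n.
rewrite distrC; apply: (@le_trans _ _ (err n)); first by near: n.
apply: (le_trans (ler_norm _)); rewrite -normrN -sub0r.
by near: n; move/cvgrPdist_le : e0; exact.
Unshelve. all: by end_near. Qed.

Let cvg1_neq0 (q : nat -> R) : q @ \oo --> (1 : R) -> \forall n \near \oo, q n != 0.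
Proof.
move=> q1; near=> n; rewrite gt_eqF//.
by near: n; exact: (cvgr_gt (1 : R) q1 0 ltr01).
Unshelve. all: by end_near. Qed.

Let cvg1_inv (q : nat -> R) : q @ \oo --> (1 : R) -> (fun n => (q n)^-1) @ \oo --> (1 : R).
Proof.
by move=> q1; rewrite -[X in _ --> X]invr1; apply: cvgV => //; exact: oner_neq0.
Qed.

Lemma equivalent_large_snr : t @ \oo --> +oo ->
  equivalent_in_distribution P (fun n w => centered_ratio n (sample_means w))
    (fun n w => Some
      (sqrtN n * gammaX n * ((sample_means w).1 - EX n) / (EY n * gammaX n)
       - sqrtN n * gammaY n * ((sample_means w).2 - EY n) * EX n
         / (EY n ^+ 2 * gammaY n))).
Proof.
move=> toy.
pose T n (z : R * R) := sqrtN n * gammaX n * (z.1 - EX n) / (EY n * gammaX n)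
       - sqrtN n * gammaY n * (z.2 - EY n) * EX n / (EY n ^+ 2 * gammaY n).
(* The square root serves both needs: [tau n] tends to infinity, as tightness requires, and so does
   [t n / tau n], which makes [B / t] small. *)
pose tau n := Num.sqrt (t n).
have tauoo : tau @ \oo --> +oo.
  apply/cvgryPge => A0.
  have tA : \forall n \near \oo, A0 ^+ 2 <= t n by move/cvgryPge : toy; exact.
  apply: filterS tA => n tA.
  by apply: (le_trans (ler_norm _)); rewrite -sqrtr_sqr; exact: ler_wsqrtr.
have tau0 n : 0 < tau n by rewrite sqrtr_gt0.
apply: (@sampling_equivalent (fun n => [set z | tau n <= `|B n z|]) centered_ratio
  (fun n z => Some (T n z))).
- move=> n; rewrite -[X in measurable X]setTI.
  have mb : measurable_fun setT (fun z => tau n <= `|B n z|).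
    apply: measurable_fun_ler => //; apply: measurableT_comp => //.
    exact: measurable_fluctuation_snd.
  exact: (mb measurableT [set true]).
- have := @fluctuation_tight (fun=> 0) (fun=> 1) tau _ tauoo.
  rewrite (_ : (fun n => fine (P n [set w | tau n <= `|0 * _ + 1 * _|])) =
    fun n => fine (P n (@sample_means n @^-1` [set z | tau n <= `|B n z|]))).
    by apply => n; rewrite expr0n expr1n add0r.
  by apply/funext => n; congr (fine (P n _)); apply/eq_set => w; rewrite mul0r mul1r add0r.
- exact: partial_RV_centered_ratio.
- move=> n; rewrite -[fun z => _]/(fun z => defined_if true (T n z)).
  apply: partial_RV_defined_if => //.
  apply: measurable_funB; apply: mdiv => //.
    exact: measurable_fluctuation_fst.
  by apply: measurable_funM => //; exact: measurable_fluctuation_snd.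
(* [S_n = T_n / q] exactly: linearizing the ratio replaces the denominator Ybar * E Y by (E Y)^2. *)
move=> z good; pose q n := (z n).2 / EY n.
have qE n : q n = 1 + B n (z n) / t n.
  rewrite /q /fluctuation_snd /t -/(EY n).
  by field; rewrite rtN0 gY0 EYN0.
have q1 : q @ \oo --> (1 : R).
  apply: (@cvg_to1 _ (fun n => (tau n)^-1)).
    apply: filterS good => n /= /negP; rewrite -ltNge => Bt.
    rewrite qE addrAC subrr add0r normrM normfV (gtr0_norm (t0 n)).
    rewrite ler_pdivrMr// -(sqr_sqrtr (ltW (t0 n))) -/(tau n) expr2 mulKf ?gt_eqF//.
    exact: ltW.
  by apply/gtr0_cvgV0; [exact: nearW|].
apply: (@partial_equivalent_ratio _ _ _
  (fun n => sqrtN n * ((z n).1 / (z n).2 - EX n / EY n)) (fun n => T n (z n))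
  (fun n => (q n)^-1)); last exact: cvg1_inv.
apply: filterS (cvg1_neq0 q1) => n qn0.
have z0 : (z n).2 != 0 by apply: contraNneq qn0 => z0; rewrite /q z0 mul0r.
split => //; first by rewrite /centered_ratio /defined_if z0.
rewrite /T /q; move: (EX n) (EY n) (EYN0 n) (sqrtN n) (gX0 n) (gY0 n) => ex ey ey0 rt gx0 gy0.
by field; rewrite z0 ey0 gx0 gy0.
Qed.

Lemma equivalent_small_snr : t @ \oo --> (0 : R) ->
  equivalent_in_distribution P (fun n w => centered_ratio n (sample_means w))
    (fun n w => defined_if
        (sqrtN n * gammaY n * ((sample_means w).2 - EY n) != 0)
        (sqrtN n * (sqrtN n * gammaX n * ((sample_means w).1 - EX n)
                    / (sqrtN n * gammaY n * ((sample_means w).2 - EY n))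
                    * (gammaY n / gammaX n)
                    - EX n / EY n))).
Proof.
move=> to0.
pose T n (z : R * R) := sqrtN n * (A n z / B n z * (gammaY n / gammaX n) - EX n / EY n).
(* The radius tends to 0, as the small-ball bound requires, while [t n / tau n = tau n] tends to 0
   too. *)
pose tau n := Num.sqrt (t n).
have tau_to0 : tau @ \oo --> (0 : R).
  rewrite -(sqrtr0 R); apply: continuous_cvg => //; exact: sqrt_continuous.
have tau0 n : 0 < tau n by rewrite sqrtr_gt0.
apply: (@sampling_equivalent (fun n => [set z | `|B n z| <= tau n]) centered_ratio
  (fun n z => defined_if (B n z != 0) (T n z))).
- move=> n; rewrite -[X in measurable X]setTI.
  have mb : measurable_fun setT (fun z => `|B n z| <= tau n).
    apply: measurable_fun_ler => //; apply: measurableT_comp => //.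
    exact: measurable_fluctuation_snd.
  exact: (mb measurableT [set true]).
- have := @fluctuation_small_ball (fun=> 0) (fun=> 1) (fun=> 0) tau _ tau_to0.
  rewrite (_ : (fun n => fine (P n [set w | `|0 * _ + 1 * _ - 0| <= tau n])) =
    fun n => fine (P n (@sample_means n @^-1` [set z | `|B n z| <= tau n]))).
    by apply => n; rewrite expr0n expr1n add0r.
  by apply/funext => n; congr (fine (P n _)); apply/eq_set => w;
    rewrite mul0r mul1r add0r subr0.
- exact: partial_RV_centered_ratio.
- move=> n; apply: partial_RV_defined_if.
    by apply: mneq0; exact: measurable_fluctuation_snd.
  apply: measurable_funM => //; apply: measurable_funB => //; apply: measurable_funM => //.
  by apply: mdiv; [exact: measurable_fluctuation_fst|exact: measurable_fluctuation_snd].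
(* [q] is Ybar / (Ybar - E Y), and again [S_n = T_n / q]. *)
move=> z good; pose q n := 1 + t n / B n (z n).
have q1 : q @ \oo --> (1 : R).
  apply: (@cvg_to1 _ tau) => //.
  apply: filterS good => n /= /negP; rewrite -ltNge => Bt.
  rewrite addrAC subrr add0r normrM normfV (gtr0_norm (t0 n)).
  rewrite ler_pdivrMr ?(lt_trans (tau0 n))// -(sqr_sqrtr (ltW (t0 n))) -/(tau n) expr2.
  by rewrite ler_pM2l// ltW.
apply: (@partial_equivalent_ratio _ _ _
  (fun n => sqrtN n * ((z n).1 / (z n).2 - EX n / EY n)) (fun n => T n (z n))
  (fun n => (q n)^-1)); last exact: cvg1_inv.
apply: filterS2 good (cvg1_neq0 q1) => n /= /negP; rewrite -ltNge => Bt qn0.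
have B0 : B n (z n) != 0 by rewrite -normr_gt0 (lt_trans (tau0 n)).
have zE0 : (z n).2 - EY n != 0.
  by apply: contraNneq B0 => z0; rewrite /fluctuation_snd z0 mulr0.
have qE : q n = (z n).2 / ((z n).2 - EY n).
  rewrite /q /t /fluctuation_snd -/(EY n); move: (EY n) zE0 => ey zE0.
  by field; rewrite rtN0 gY0 zE0.
have z0 : (z n).2 != 0 by apply: contraNneq qn0 => z0; rewrite qE z0 mul0r.
split; first by rewrite /centered_ratio /defined_if z0.
  by rewrite /defined_if B0.
rewrite qE /T /fluctuation_fst /fluctuation_snd -/(EX n) -/(EY n).
move: (EX n) (EY n) zE0 (EYN0 n) (sqrtN n) (rtN0 n) (gX0 n) (gY0 n)
  => ex ey zE0 ey0 rt rt0 gx0 gy0.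
by field; rewrite z0 ey0 gx0 gy0 zE0 rt0.
Qed.


Lemma equivalent_moderate_snr (C : R) : C != 0 -> t @ \oo --> C ->
  equivalent_in_distribution P (fun n w => centered_ratio n (sample_means w))
    (fun n w => defined_if
        (C + sqrtN n * gammaY n * ((sample_means w).2 - EY n) != 0)
        (n.+1%:R * gammaY n * EX n
           * ((C + sqrtN n * gammaY n * ((sample_means w).2 - EY n))^-1 - C^-1)
         + n.+1%:R * gammaX n * ((sample_means w).1 - EX n) * gammaY n
           / ((C + sqrtN n * gammaY n * ((sample_means w).2 - EY n)) * gammaX n))).
Proof.
move=> C0 toC.
pose T n (z : R * R) := n.+1%:R * gammaY n * EX n * ((C + B n z)^-1 - C^-1)
  + n.+1%:R * gammaX n * (z.1 - EX n) * gammaY n / ((C + B n z) * gammaX n).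
(* The second term keeps [e n] positive when [t n = C], so that it can be inverted below. *)
pose e n := `|t n - C| + n.+1%:R^-1.
have e0 n : 0 < e n by rewrite ltr_wpDl// invr_gt0.
have e_to0 : e @ \oo --> (0 : R).
  rewrite -[X in _ --> X]addr0; apply: cvgD; last exact: cvg_harmonic.
  rewrite -(normr0 R) -(subrr C); apply: cvg_norm; apply: cvgB => //; exact: cvg_cst.
(* A fourth root, because the error [|t - C|] of order [D ^+ 4] is multiplied by [|A| < D^-1] and
   divided by [|Q|], of order at least [D]; this leaves [D ^+ 2]. *)
pose D n := Num.sqrt (Num.sqrt (e n)).
have D0 n : 0 < D n by rewrite !sqrtr_gt0.
have D4 n : D n ^+ 4 = e n.
  by rewrite (exprM _ 2 2) !sqr_sqrtr// ?sqrtr_ge0// ltW.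
have sqrt0 (u : nat -> R) : u @ \oo --> (0 : R) -> (fun n => Num.sqrt (u n)) @ \oo --> (0 : R).
  by move=> u0; rewrite -(sqrtr0 R); apply: continuous_cvg => //; exact: sqrt_continuous.
have D_to0 : D @ \oo --> (0 : R) by apply: (sqrt0); exact: sqrt0.
have D2_to0 : (fun n => D n ^+ 2) @ \oo --> (0 : R).
  by rewrite -[X in _ --> X](mul0r 0); exact: (cvgM D_to0 D_to0).
have tC n : `|t n - C| <= D n ^+ 4 by rewrite D4 lerDl invr_ge0.
pose r n := sqrtN n * gammaX n * EX n.
pose rho n := Num.sqrt (C ^+ 2 + r n ^+ 2).
have C2 : 0 < C ^+ 2 by rewrite exprn_even_gt0.
have rho2 n : rho n ^+ 2 = C ^+ 2 + r n ^+ 2 by rewrite sqr_sqrtr// addr_ge0 ?sqr_ge0.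
have rho0 n : 0 < rho n by rewrite sqrtr_gt0 ltr_pwDl// sqr_ge0.
have rhoC n : `|C| <= rho n.
  by rewrite -sqrtr_sqr ler_wsqrtr// lerDl sqr_ge0.
(* [Q n] below, the denominator of the relative error, is [rho n] times a fluctuation in
   a direction of unit length. *)
pose al n := C / rho n; pose be n := - r n / rho n.
have ab1 n : al n ^+ 2 + be n ^+ 2 = 1.
  by rewrite !expr_div_n sqrrN -mulrDl -rho2 divff// expf_neq0// gt_eqF.
(* The three sets make C + B small, A large, and the normalized [Q] small, respectively. *)
pose bad n := [set z | `|C + B n z| <= D n] `|` [set z | (D n)^-1 <= `|A n z|]
  `|` [set z | `|al n * A n z + be n * B n z| <= D n].
have mA n := @measurable_fluctuation_fst n.
have mB n := @measurable_fluctuation_snd n.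
have mle (f g : R * R -> R) : measurable_fun setT f -> measurable_fun setT g ->
    measurable [set z | f z <= g z].
  move=> mf mg; rewrite -[X in measurable X]setTI.
  have mb : measurable_fun setT (fun z => f z <= g z) by exact: measurable_fun_ler.
  exact: (mb measurableT [set true]).
have mbad1 n : measurable [set z | `|C + B n z| <= D n].
  by apply: mle => //; apply: measurableT_comp => //; exact: measurable_funD.
have mbad2 n : measurable [set z | (D n)^-1 <= `|A n z|].
  by apply: mle => //; exact: measurableT_comp.
have mbad3 n : measurable [set z | `|al n * A n z + be n * B n z| <= D n].
  apply: mle => //; apply: measurableT_comp => //.
  by apply: measurable_funD; exact: measurable_funM.
have mpre n (E : set (R * R)) : measurable E -> measurable (@sample_means n @^-1` E).
  by move=> mE; rewrite -[X in measurable X]setTI; exact: measurable_sample_means.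
have PU (E1 E2 : nat -> set (R * R)) :
    (forall n, measurable (E1 n)) -> (forall n, measurable (E2 n)) ->
    (fun n => fine (P n (@sample_means n @^-1` E1 n))) @ \oo --> (0 : R) ->
    (fun n => fine (P n (@sample_means n @^-1` E2 n))) @ \oo --> (0 : R) ->
    (fun n => fine (P n (@sample_means n @^-1` (E1 n `|` E2 n)))) @ \oo --> (0 : R).
  move=> mE1 mE2 E10 E20.
  apply: (@squeeze_cvgr _ _ _ _ (fun=> 0) (fun n => fine (P n (@sample_means n @^-1` E1 n)) +
    fine (P n (@sample_means n @^-1` E2 n)))); last 2 first.
  - exact: cvg_cst.
  - by rewrite -[X in _ --> X]addr0; exact: cvgD.
  apply: nearW => n; rewrite fine_ge0//= -lee_fin EFinD !fineK ?fin_num_measure//;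
    [|exact: mpre..|].
    by rewrite preimage_setU; apply: measureU2; exact: mpre.
  by apply: mpre; exact: measurableU.
apply: (@sampling_equivalent bad centered_ratio
  (fun n z => defined_if (C + B n z != 0) (T n z))).
- by move=> n; apply: measurableU => //; exact: measurableU.
- apply: (PU) => //; first by move=> n; exact: measurableU.
    apply: (PU) => //.
      have := @fluctuation_small_ball (fun=> 0) (fun=> 1) (fun=> - C) D _ D_to0.
      rewrite (_ : (fun n => fine (P n [set w | `|0 * _ + 1 * _ - - C| <= D n])) =
        fun n => fine (P n (@sample_means n @^-1` [set z | `|C + B n z| <= D n]))).
        by apply => n; rewrite expr0n expr1n add0r.
      apply/funext => n; congr (fine (P n _)); apply/eq_set => w.
      by rewrite mul0r mul1r add0r opprK addrC.
    have Doo : (fun n => (D n)^-1) @ \oo --> +oo.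
      apply/cvgryPge => a; near=> n.
      apply: (le_trans (ler_norm a)).
      apply: (@le_trans _ _ (`|a| + 1)); first by rewrite lerDl.
      rewrite -[leLHS]invrK lef_pV2 ?posrE// ?invr_gt0 ?ltr_wpDl//.
      apply: (le_trans (ler_norm _)); rewrite -normrN -sub0r.
      have a1 : 0 < (`|a| + 1)^-1 by rewrite invr_gt0 ltr_wpDl.
      by near: n; move/cvgrPdist_le : D_to0; apply.
    have := @fluctuation_tight (fun=> 1) (fun=> 0) _ _ Doo.
    rewrite (_ : (fun n => fine (P n [set w | (D n)^-1 <= `|1 * _ + 0 * _|])) =
      fun n => fine (P n (@sample_means n @^-1` [set z | (D n)^-1 <= `|A n z|]))).
      by apply => n; rewrite expr0n expr1n addr0.
    by apply/funext => n; congr (fine (P n _)); apply/eq_set => w; rewrite mul0r mul1r addr0.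
  have := @fluctuation_small_ball al be (fun=> 0) D ab1 D_to0.
  rewrite (_ : (fun n => fine (P n [set w | `|_ - 0| <= D n])) = fun n =>
    fine (P n (@sample_means n @^-1` [set z | `|al n * A n z + be n * B n z| <= D n])))//.
  by apply/funext => n; congr (fine (P n _)); apply/eq_set => w; rewrite subr0.
- exact: partial_RV_centered_ratio.
- move=> n; have mCB : measurable_fun setT (fun z => C + B n z) by exact: measurable_funD.
  apply: partial_RV_defined_if; first exact: mneq0.
  apply: measurable_funD.
    apply: measurable_funM => //; apply: measurable_funB => //.
    exact: (measurableT_comp (@measurable_invr R)).
  apply: mdiv; last exact: measurable_funM.
  by do 2 apply: measurable_funM => //; exact: measurable_funB.
move=> z good.
pose Q n := C * A n (z n) - r n * B n (z n).
have QE n : Q n = rho n * (al n * A n (z n) + be n * B n (z n)).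
  by rewrite /Q /al /be; field; rewrite gt_eqF.
(* Since [rho n >= |C|], the bound on the normalized combination gives one on [Q n] that does not
   involve the possibly unbounded [r n]. *)
have goodE : \forall n \near \oo, [/\ D n < `|C + B n (z n)|,
    `|A n (z n)| < (D n)^-1 & `|C| * D n < `|Q n|].
  apply: filterS good => n /= h; split; rewrite ltNge; apply/negP => k; apply: h.
  - by left; left.
  - by left; right.
  - right; move: k; rewrite QE normrM (gtr0_norm (rho0 n)) => k /=.
    rewrite -(@ler_pM2l _ (rho n))//; apply: (le_trans k).
    by rewrite ler_pM2r.
(* The ratio of the two sequences is [q1 n / (q2 n * q3 n)]. *)
pose q1 n := 1 + A n (z n) * (t n - C) / Q n.
pose q2 n := t n / C.
pose q3 n := 1 + (t n - C) / (C + B n (z n)).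
have q1_1 : q1 @ \oo --> (1 : R).
  apply: (@cvg_to1 _ (fun n => D n ^+ 2 * `|C|^-1)).
    apply: filterS goodE => n [_ An Qn].
    rewrite addrAC subrr add0r normrM normfV normrM.
    have Q0 : 0 < `|Q n| by apply: le_lt_trans Qn; rewrite mulr_ge0// ltW.
    rewrite ler_pdivrMr//.
    apply: (@le_trans _ _ ((D n)^-1 * D n ^+ 4)).
      exact: (ler_pM (normr_ge0 _) (normr_ge0 _) (ltW An) (tC n)).
    have -> : (D n)^-1 * D n ^+ 4 = D n ^+ 2 / `|C| * (`|C| * D n).
      by field; rewrite normr_eq0 C0 gt_eqF.
    by rewrite ler_wpM2l ?(ltW Qn)// divr_ge0 ?sqr_ge0.
  by rewrite -[X in _ --> X](mul0r `|C|^-1); apply: cvgM => //; exact: cvg_cst.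
have q2_1 : q2 @ \oo --> (1 : R).
  by rewrite -(divff C0); apply: cvgM => //; exact: cvg_cst.
have q3_1 : q3 @ \oo --> (1 : R).
  apply: (@cvg_to1 _ (fun n => D n ^+ 3)).
    apply: filterS goodE => n [CB _ _].
    rewrite addrAC subrr add0r normrM normfV ler_pdivrMr ?(lt_trans (D0 n))//.
    apply: (le_trans (tC n)); rewrite exprSr ler_wpM2l ?(ltW CB)//.
    by rewrite exprn_ge0// ltW.
  by rewrite -[X in _ --> X](mul0r 0); exact: (cvgM D_to0 D2_to0).
apply: (@partial_equivalent_ratio _ _ _
  (fun n => sqrtN n * ((z n).1 / (z n).2 - EX n / EY n)) (fun n => T n (z n))
  (fun n => q1 n * ((q2 n)^-1 * (q3 n)^-1))); last first.
  rewrite -(mulr1 (1 : R)); apply: cvgM => //; rewrite -(mulr1 (1 : R)).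
  by apply: cvgM; exact: cvg1_inv.
apply: filterS2 goodE (cvg1_neq0 q3_1) => n [CB _ Qn] q3n0.
have CB0 : C + B n (z n) != 0 by rewrite -normr_gt0 (lt_trans (D0 n)).
have Q0 : Q n != 0 by rewrite -normr_gt0; apply: le_lt_trans Qn; rewrite mulr_ge0// ltW.
have q3E : q3 n = sqrtN n * gammaY n * (z n).2 / (C + B n (z n)).
  rewrite /q3 /t -[X in X + _](divff CB0) -mulrDl; congr (_ / _).
  by rewrite /fluctuation_snd -/(EY n); ring.
have z0 : (z n).2 != 0 by apply: contraNneq q3n0 => z0; rewrite q3E z0 mulr0 mul0r.
split.
- by rewrite /centered_ratio /defined_if z0.
- by rewrite /defined_if CB0.
(* [Q + A (t - C)] is t A - r B, in which the products of means cancel. *)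
have q1E : q1 n = sqrtN n * gammaX n * sqrtN n * gammaY n *
    ((z n).1 * EY n - EX n * (z n).2) / Q n.
  rewrite /q1 -[X in X + _](divff Q0) -mulrDl; congr (_ / _).
  by rewrite /Q /r /t /fluctuation_fst /fluctuation_snd -/(EX n) -/(EY n); ring.
have TE : T n (z n) = sqrtN n * gammaY n / (gammaX n * C * (C + B n (z n))) * Q n.
  rewrite /T -sqr_sqrtN /Q /r /fluctuation_fst -/(EX n).
  by move: (B n (z n)) CB0 => b CB0; field; rewrite gX0 C0 CB0.
rewrite TE q1E q3E /q2 /t.
move: (Q n) Q0 (C + B n (z n)) CB0 => qn qn0 cb cb0.
move: (EX n) (EY n) (EYN0 n) (sqrtN n) (rtN0 n) (gX0 n) (gY0 n) => ex ey ey0 rt rt0 gx0 gy0.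
by field; rewrite z0 ey0 gx0 gy0 rt0 qn0 cb0 C0.
Unshelve. all: by end_near. Qed.

End triangular_array.

(* Sequences indexed by the sample size N >= 1 are reindexed by n = N - 1: row n
   of the array has N = n.+1 observations, and [ord0] is the first of them.
   Indices of 'I_2 are 0 and 1, so [V 1 1] is the lower right entry of V. *)
Theorem theorem3p1 (R : realType) (d : nat -> measure_display)
    (Omega : forall n : nat, measurableType (d n))
    (P : forall n : nat, probability (Omega n) R)
    (X Y : forall n : nat, 'I_n.+1 -> {RV (P n) >-> R})
    (PXY : nat -> probability (R * R)%type R)
    (gammaX gammaY : nat -> R) (V : 'M[R]_2)
    (EX : nat -> R := fun n => fine ('E_(P n)[X n ord0])%E)
    (EY : nat -> R := fun n => fine ('E_(P n)[Y n ord0])%E)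
    (Xbar : forall n, Omega n -> R := fun n =>
       empirical_mean (X n))
    (Ybar : forall n, Omega n -> R := fun n =>
       empirical_mean (Y n))
    (sqrtN : nat -> R := fun n => Num.sqrt n.+1%:R)
    (SNR : nat -> R := fun n =>
       EY n / (Num.sqrt (V 1 1) * (sqrtN n)^-1 * (gammaY n)^-1))
    (S : forall n, Omega n -> option R := fun n w => defined_if (Ybar n w != 0)
       (sqrtN n * (Xbar n w / Ybar n w - EX n / EY n))) :
  (forall n, iid_with_law (P n) (PXY n)
     (fun (i : 'I_n.+1) (w : Omega n) => (X n i w, Y n i w))) ->
  (forall n, (0 < 'E_(P n)[Y n ord0])%E) ->
  (forall n, ('E_(P n)[fun w : Omega n => (X n ord0 w ^+ 2)%R] < +oo)%E) ->
  (forall n, ('E_(P n)[fun w : Omega n => (Y n ord0 w ^+ 2)%R] < +oo)%E) ->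
  (forall n, 0 < gammaX n) ->
  (forall n, 0 < gammaY n) ->
  positive_definite V ->
  (fun n => covariance_matrix (P n) (fun (i : 'I_2) (w : Omega n) =>
     if i == 0 then gammaX n * X n ord0 w else gammaY n * Y n ord0 w))
    @ \oo --> V ->
  (ereal_sup (range (fun n => 'E_(P n)[fun w : Omega n =>
     (`|X n ord0 w| ^+ 3 * gammaX n ^+ 3
      + `|Y n ord0 w| ^+ 3 * gammaY n ^+ 3)%R]))
   < +oo)%E ->
  (fun n => P n [set w | Ybar n w = 0]) @ \oo --> 0%E ->
  [/\ SNR @ \oo --> +oo ->
      equivalent_in_distribution P S (fun n w => Some
        (sqrtN n * gammaX n * (Xbar n w - EX n) / (EY n * gammaX n)
         - sqrtN n * gammaY n * (Ybar n w - EY n) * EX n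
           / (EY n ^+ 2 * gammaY n))),
      forall C : R, C != 0 ->
      (fun n => Num.sqrt (V 1 1) * SNR n) @ \oo --> C ->
      equivalent_in_distribution P S (fun n w => defined_if
        (C + sqrtN n * gammaY n * (Ybar n w - EY n) != 0)
        (n.+1%:R * gammaY n * EX n
           * ((C + sqrtN n * gammaY n * (Ybar n w - EY n))^-1 - C^-1)
         + n.+1%:R * gammaX n * (Xbar n w - EX n) * gammaY n
           / ((C + sqrtN n * gammaY n * (Ybar n w - EY n)) * gammaX n))) &
      SNR @ \oo --> 0 ->
      equivalent_in_distribution P S (fun n w => defined_if
        (sqrtN n * gammaY n * (Ybar n w - EY n) != 0)
        (sqrtN n * (sqrtN n * gammaX n * (Xbar n w - EX n)
                    / (sqrtN n * gammaY n * (Ybar n w - EY n))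
                    * (gammaY n / gammaX n)
                    - EX n / EY n)))].
Proof.
move=> iid EY0 _ _ gX0 gY0 Vpos covV sup3 _.
have [K K3] : exists K : R, forall n, ('E_(P n)[fun w : Omega n =>
    (`|X n ord0 w| ^+ 3 * gammaX n ^+ 3
     + `|Y n ord0 w| ^+ 3 * gammaY n ^+ 3)%R] <= K%:E)%E.
  set f := fun n => _ in sup3.
  have f_le n : (f n <= ereal_sup (range f))%E by apply: ereal_sup_ubound; exists n.
  case: (ereal_sup _) f_le sup3 => [K fK _|//|fK _]; first by exists K.
  by exists 0 => n; apply: (le_trans (fK n)); exact: leNye.
have [_ _ V11 _] := positive_definite2 Vpos.
have sV : 0 < Num.sqrt (V 1 1) by rewrite sqrtr_gt0.
(* The factor [V 1 1 ^ (1/2)] is positive and cancels, so each regime of SNR becomes a condition on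
   t. *)
have tE n : sqrtN n * gammaY n * EY n = Num.sqrt (V 1 1) * SNR n.
  rewrite /SNR; field.
  by rewrite !gt_eqF// sqrtr_gt0.
have t_fun : (fun n => sqrtN n * gammaY n * EY n) = fun n => Num.sqrt (V 1 1) * SNR n.
  exact/funext.
split.
- move=> SNRoo; apply: (equivalent_large_snr iid gX0 gY0 Vpos covV K3 EY0).
  rewrite [X in X @ _](_ : _ = fun n => Num.sqrt (V 1 1) * SNR n)//.
  apply/cvgryPge => a.
  have : \forall n \near \oo, a / Num.sqrt (V 1 1) <= SNR n.
    by move/cvgryPge : SNRoo; exact.
  by apply: filterS => n; rewrite ler_pdivrMr// mulrC.
- move=> C C0 SNRC; apply: (equivalent_moderate_snr iid gX0 gY0 Vpos covV K3 EY0 C0).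
  by rewrite [X in X @ _](_ : _ = fun n => Num.sqrt (V 1 1) * SNR n).
- move=> SNR0; apply: (equivalent_small_snr iid gX0 gY0 Vpos covV K3 EY0).
  rewrite [X in X @ _](_ : _ = fun n => Num.sqrt (V 1 1) * SNR n)//.
  by rewrite -[X in _ --> X](mulr0 (Num.sqrt (V 1 1))); apply: cvgM => //; exact: cvg_cst.
Qed.
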